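(* Let $\mathsf{F} = \mathsf{F}_q$ be the finite field with size $q$. Let $m$ and $n$ be integers such that $n \ge m \ge 0$ and $n \ge 1$. Let $\ell$, $\sigma$, $\tau$, $\upsilon$ be the constants (depending on $q$, but independent of $n$ and $m$) given by the table in the context. There exists a random procedure (depending on $q$, $m$, $n$ only, and not on the matrix $A$ below) for generating $n-m+\ell$ row vectors in $\mathsf{F}^{1 \times n}$ such that the following hold. (1) The expected total number of nonzero entries in the generated rows is at most $\sigma n \ln n + \tau n$ if $n - m \ge \upsilon$, and at most $\frac{q-1}{q}(n-m+\ell)n \le \frac{q-1}{q}(\upsilon+\ell)n$ otherwise. (2) For every matrix $A \in \mathsf{F}^{m \times n}$ of rank $m$, let $B \in \mathsf{F}^{(n+\ell) \times n}$ be the matrix obtained from $A$ by appending the generated rows. If $q \le n^2$ then $B$ has maximal rank $n$ with probability at least $\frac{9}{10}$. If $q > n^2$ then $B$ has maximal rank $n$ with probability at least $\frac{9}{10} - \frac{9}{10n}$.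
   Context: The constants $(\ell,\sigma,\tau,\upsilon)$ are determined by the field size $q$ (a prime power) as follows: - $q=2$: $\ell=8$, $\sigma=\frac{43}{2}$, $\tau=17$, $\upsilon=41$. - $q=3$: $\ell=5$, $\sigma=16$, $\tau=11$, $\upsilon=55$. - $q=4$: $\ell=4$, $\sigma=\frac{225}{16}$, $\tau=9$, $\upsilon=65$. - $q=5$: $\ell=4$, $\sigma=\frac{64}{5}$, $\tau=8$, $\upsilon=75$. - $q=7$: $\ell=3$, $\sigma=\frac{78}{7}$, $\tau=7$, $\upsilon=96$. - $q=8$: $\ell=3$, $\sigma=\frac{21}{2}$, $\tau=6$, $\upsilon=108$. - $q=9$: $\ell=3$, $\sigma=\frac{88}{9}$, $\tau=6$, $\upsilon=124$. - $q=11$: $\ell=3$, $\sigma=\frac{105}{11}$, $\tau=6$, $\upsilon=136$. - $q=13$: $\ell=3$, $\sigma=\frac{120}{13}$, $\tau=6$, $\upsilon=150$. - $16\le q\le 19$: $\ell=2$, $\sigma=\frac{9(q-1)}{q}$, $\tau=5$, $\upsilon=194$. - $23\le q\le 29$: $\ell=2$, $\sigma=\frac{8(q-1)}{q}$, $\tau=4$, $\upsilon=285$. - $31\le q\le 43$: $\ell=2$, $\sigma=\frac{15(q-1)}{2q}$, $\tau=4$, $\upsilon=381$. - $47\le q\le 59$: $\ell=2$, $\sigma=\frac{7(q-1)}{q}$, $\tau=4$, $\upsilon=577$. - $61\le q\le 71$: $\ell=2$, $\sigma=\frac{27(q-1)}{4q}$, $\tau=4$, $\upsilon=783$. - $73\le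 q\le 83$: $\ell=2$, $\sigma=\frac{33(q-1)}{5q}$, $\tau=4$, $\upsilon=996$. - $q\ge 89$: $\ell=2$, $\sigma=\frac{13(q-1)}{2q}$, $\tau=4$, $\upsilon=1213$. A ''random procedure'' is a probability distribution on $(n-m+\ell)$-tuples of vectors in $\mathsf{F}^{1\times n}$. *)

(* Defs.v *)
From HB Require Import structures.
From mathcomp Require Import all_boot all_order all_algebra.
From mathcomp Require Import reals exp.

Set Implicit Arguments.
Unset Strict Implicit.
Unset Printing Implicit Defensive.

Import Order.TTheory GRing.Theory Num.Theory.

Local Open Scope ring_scope.

(* The constants depending on the field size q.  They are only meaningful for
   prime powers q; since no prime power lies strictly between two consecutive
   ranges (e.g. 20, 21, 22 between 16..19 and 23..29), testing the upper ends of
   the ranges in increasing order suffices. *)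

Definition ell (q : nat) : nat :=
  if (q <= 2)%N then 8
  else if (q <= 3)%N then 5
  else if (q <= 5)%N then 4
  else if (q <= 13)%N then 3
  else 2.

Definition sigma (R : realType) (q : nat) : R :=
  if (q <= 2)%N then 43 / 2
  else if (q <= 3)%N then 16
  else if (q <= 4)%N then 225 / 16
  else if (q <= 5)%N then 64 / 5
  else if (q <= 7)%N then 78 / 7
  else if (q <= 8)%N then 21 / 2
  else if (q <= 9)%N then 88 / 9
  else if (q <= 11)%N then 105 / 11
  else if (q <= 13)%N then 120 / 13
  else if (q <= 19)%N then (9 * (q%:R - 1)) / q%:R
  else if (q <= 29)%N then (8 * (q%:R - 1)) / q%:R
  else if (q <= 43)%N then (15 * (q%:R - 1)) / (2 * q%:R)
  else if (q <= 59)%N then (7 * (q%:R - 1)) / q%:R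
  else if (q <= 71)%N then (27 * (q%:R - 1)) / (4 * q%:R)
  else if (q <= 83)%N then (33 * (q%:R - 1)) / (5 * q%:R)
  else (13 * (q%:R - 1)) / (2 * q%:R).

Definition tau (q : nat) : nat :=
  if (q <= 2)%N then 17
  else if (q <= 3)%N then 11
  else if (q <= 4)%N then 9
  else if (q <= 5)%N then 8
  else if (q <= 7)%N then 7
  else if (q <= 13)%N then 6
  else if (q <= 19)%N then 5
  else 4.

Definition upsilon (q : nat) : nat :=
  if (q <= 2)%N then 41
  else if (q <= 3)%N then 55
  else if (q <= 4)%N then 65
  else if (q <= 5)%N then 75
  else if (q <= 7)%N then 96
  else if (q <= 8)%N then 108
  else if (q <= 9)%N then 124
  else if (q <= 11)%N then 136
  else if (q <= 13)%N then 150
  else if (q <= 19)%N then 194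
  else if (q <= 29)%N then 285
  else if (q <= 43)%N then 381
  else if (q <= 59)%N then 577
  else if (q <= 71)%N then 783
  else if (q <= 83)%N then 996
  else 1213.

Record fdist (R : realType) (T : finType) := FDist {
  fdist_fun :> {ffun T -> R};
  fdist_ge0 : forall x, 0 <= fdist_fun x;
  fdist_sum1 : \sum_(x : T) fdist_fun x = 1
}.

Definition Pr (R : realType) (T : finType) (P : fdist R T) (E : pred T) : R :=
  \sum_(x | E x) P x.

Definition Ex (R : realType) (T : finType) (P : fdist R T) (X : T -> R) : R :=
  \sum_(x : T) P x * X x.

Definition rows_mx (F : finFieldType) (k n : nat)
    (v : k.-tuple 'rV[F]_n) : 'M[F]_(k, n) :=
  \matrix_(i < k) tnth v i.

Definition nonzero_entries (F : finFieldType) (k n : nat)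
    (v : k.-tuple 'rV[F]_n) : nat :=
  (\sum_(i < k) #|[pred j : 'I_n | (tnth v i ord0 j != 0)%R]|)%N.

(* Main.v *)
(** All entries of the generated rows are independent, zero with probability
    [1 - p] and uniform on the nonzero elements otherwise.  Put [k = n - m].
    - Writing [p = (1 - 1/q)(1 - rho)], an entry is zero with probability [rho]
      and uniform on [F] otherwise, so a random row annihilates a vector of weight
      [w] with probability [(1 + (q - 1) rho^w) / q].
    - The matrix [B] has rank [n] unless some nonzero vector of [ker A] is
      annihilated by all generated rows.  Parametrizing [ker A] by [k] of its
      coordinates does not increase weights, so a union bound over the nonzero
      vectors of [F^k] applies and no longer involves [A].
    - If [k < upsilon q] take [rho = 0].  Otherwise take [rho = 1 - s ln k / k]
      with [s = 16] or [s = 6], so that [rho^k <= k^-s]: the union bound is then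
      at most [1/20] provided that [q - 1 < 20 k].
    - If [q - 1 >= 20 k], use the density suited to the field with 11 elements:
      there full rank forces a matching in the support of the rows, and over
      [F] a matching makes the rank full up to probability [k / (q - 1)]. *)
Require Import Defs.
From HB Require Import structures.
From mathcomp Require Import all_boot all_order all_fingroup all_algebra.
From mathcomp Require Import reals sequences exp ring lra zify.

Set Implicit Arguments.
Unset Strict Implicit.
Unset Printing Implicit Defensive.

Import Order.TTheory GRing.Theory Num.Theory.

Local Open Scope ring_scope.

(** * Random matrices with independent entries *)

(** Independence of the rows: a matrix is a free choice of its rows, so this is the general
    distributive law. *)
Lemma sum_mx_rows (R : comPzSemiRingType) (T : finType) (k n : nat)
    (f : 'I_k -> 'rV[T]_n -> R) :
  \sum_(M : 'M[T]_(k, n)) \prod_i f i (row i M) = \prod_i \sum_v f i v.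
Proof.
rewrite bigA_distr_bigA /=.
rewrite (reindex (fun h : {ffun 'I_k -> 'rV[T]_n} => \matrix_i h i)) /=; last first.
  exists (fun M => [ffun i => row i M]) => [h _|M _].
    by apply/ffunP=> i; rewrite ffunE rowK.
  by apply/row_matrixP=> i; rewrite rowK ffunE.
by apply: eq_bigr => h _; apply: eq_bigr => i _; rewrite rowK.
Qed.

Lemma sum_rV_prod (R : comPzSemiRingType) (T : finType) (n : nat)
    (f : 'I_n -> T -> R) :
  \sum_(v : 'rV[T]_n) \prod_j f j (v 0 j) = \prod_j \sum_a f j a.
Proof.
rewrite bigA_distr_bigA /=.
rewrite (reindex (fun h : {ffun 'I_n -> T} => \row_j h j)) /=; last first.
  exists (fun v => [ffun j => v 0 j]) => [h _|v _].
    by apply/ffunP=> i; rewrite ffunE mxE.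
  by apply/rowP=> i; rewrite mxE ffunE.
by apply: eq_bigr => h _; apply: eq_bigr => i _; rewrite mxE.
Qed.

Lemma sum_mx_prod (R : comPzSemiRingType) (T : finType) (k n : nat)
    (f : 'I_k -> 'I_n -> T -> R) :
  \sum_(M : 'M[T]_(k, n)) \prod_i \prod_j f i j (M i j)
  = \prod_i \prod_j \sum_a f i j a.
Proof.
under [RHS]eq_bigr do rewrite -sum_rV_prod.
rewrite -(sum_mx_rows (fun i v => \prod_j f i j (v 0 j))).
by apply: eq_bigr => M _; do 2![apply: eq_bigr => ? _]; rewrite mxE.
Qed.

Definition rV_cons (T : Type) (n : nat) (a : T) (v : 'rV[T]_n) : 'rV[T]_n.+1 :=
  row_mx (\row__ a) v : 'rV_(1 + n).

Lemma rV_cons0 (T : Type) (n : nat) (a : T) (v : 'rV[T]_n) : rV_cons a v 0 0 = a.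
Proof. by rewrite mxE; case: splitP => // j; rewrite mxE. Qed.

Lemma rV_consS (T : Type) (n : nat) (a : T) (v : 'rV[T]_n) (j : 'I_n) :
  rV_cons a v 0 (lift ord0 j) = v 0 j.
Proof.
have -> : lift ord0 j = rshift 1 j by apply/val_inj.
exact: row_mxEr.
Qed.

Lemma big_rV_recl (S : Type) (idx : S) (op : Monoid.com_law idx) (T : finType)
    (n : nat) (G : 'rV[T]_n.+1 -> S) :
  \big[op/idx]_v G v = \big[op/idx]_a \big[op/idx]_(v : 'rV[T]_n) G (rV_cons a v).
Proof.
rewrite pair_big (reindex (fun u : T * 'rV[T]_n => rV_cons u.1 u.2)) //=.
pose g (v : 'rV[T]_(1 + n)) : T * 'rV[T]_n := (v 0 0, rsubmx v).
exists g => [[a v] _|v _].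
  by rewrite /g /= rV_cons0 row_mxKr.
rewrite /g /rV_cons /= -[RHS](hsubmxK (v : 'rV_(1 + n))).
have -> // : \row__ v 0 0 = lsubmx (v : 'rV_(1 + n)).
by apply/rowP=> i; rewrite !mxE; congr (v _ _); apply/val_inj; case: i => -[].
Qed.

Section EntryDist.
Variables (R : realFieldType) (F : finFieldType).

Lemma card_field_gt1 : 1 < #|F|%:R :> R.
Proof. by rewrite ltr1n card_finNzRing_gt1. Qed.

Definition entry_dist (p : R) (a : F) : R :=
  if a == 0 then 1 - p else p / (#|F|%:R - 1).

Definition mx_dist (p : R) (k n : nat) (M : 'M[F]_(k, n)) : R :=
  \prod_i \prod_j entry_dist p (M i j).

Lemma entry_dist_ge0 p a : 0 <= p <= 1 -> 0 <= entry_dist p a.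
Proof.
move=> /andP[p0 p1]; rewrite /entry_dist; case: ifP => _; first lra.
by rewrite divr_ge0 // subr_ge0 ltW // card_field_gt1.
Qed.

Lemma sum_entry_dist_nz p : \sum_(a | a != 0) entry_dist p a = p.
Proof.
rewrite (eq_bigr (fun=> p / (#|F|%:R - 1))); last first.
  by move=> a /negbTE; rewrite /entry_dist => ->.
have q1 := card_field_gt1.
have qE : #|F|%:R = 1 + #|F|.-1%:R :> R.
  by rewrite nat1r prednK // ltnW // card_finNzRing_gt1.
have {}qE : #|F|.-1%:R = #|F|%:R - 1 :> R by rewrite qE addrAC subrr add0r.
rewrite sumr_const; set c := #|_|.
have -> : c = #|F|.-1 by rewrite -(cardC1 (0 : F)).
by rewrite -[_ *+ _]mulr_natr qE divfK // gt_eqF // subr_gt0.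
Qed.

Lemma sum_entry_dist p : \sum_a entry_dist p a = 1.
Proof.
by rewrite (bigD1 0) //= sum_entry_dist_nz /entry_dist eqxx; lra.
Qed.

Lemma mx_dist_ge0 p k n (M : 'M_(k, n)) : 0 <= p <= 1 -> 0 <= mx_dist p M.
Proof. by move=> ?; do 2![apply: prodr_ge0 => ? _]; apply: entry_dist_ge0. Qed.

Lemma sum_mx_dist p k n : \sum_(M : 'M_(k, n)) mx_dist p M = 1.
Proof.
rewrite /mx_dist (sum_mx_prod (fun _ _ a => entry_dist p a)).
by rewrite big1 // => i _; rewrite big1 // => j _; rewrite sum_entry_dist.
Qed.

Lemma sum_mx_dist_nz p k n (i : 'I_k) (j : 'I_n) :
  \sum_(M : 'M_(k, n) | M i j != 0) mx_dist p M = p.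
Proof.
(* Placing the indicator at position [(i, j)] alone turns the event into a product over all
   entries. *)
pose f i' j' a := entry_dist p a * (if (i' == i) && (j' == j) then (a != 0)%:R else 1).
transitivity (\sum_(M : 'M_(k, n)) \prod_i \prod_j f i j (M i j)).
  rewrite big_mkcond /=; apply: eq_bigr => M _.
  under [RHS]eq_bigr do rewrite big_split /=.
  rewrite big_split /= -/(mx_dist p M).
  rewrite [X in _ = _ * X](bigD1 i) //= [X in _ = _ * (_ * X)]big1 ?mulr1; last first.
    by move=> i' /negbTE->; rewrite big1.
  rewrite (bigD1 j) //= !eqxx big1 ?mulr1; last first.
    by move=> j' /negbTE->.
  by case: ifP; rewrite ?mulr1 ?mulr0.
rewrite sum_mx_prod (bigD1 i) //= [X in _ * X]big1 ?mulr1; last first.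
  move=> i' /negbTE e; rewrite big1 // => j' _.
  by under eq_bigr do rewrite /f e mulr1; exact: sum_entry_dist.
rewrite (bigD1 j) //= [X in _ * X]big1 ?mulr1; last first.
  move=> j' /negbTE e.
  by under eq_bigr do rewrite /f e andbF mulr1; exact: sum_entry_dist.
rewrite -[RHS]sum_entry_dist_nz [RHS]big_mkcond /=; apply: eq_bigr => a _.
by rewrite /f !eqxx; case: ifP; rewrite ?mulr1 ?mulr0.
Qed.

Definition weight n (x : 'cV[F]_n) : nat := \sum_i (x i 0 != 0)%R.

Lemma entry_dist_mix (p rho : R) (a : F) :
    p = (1 - #|F|%:R^-1) * (1 - rho) ->
  entry_dist p a = rho * (a == 0)%:R + (1 - rho) / #|F|%:R.
Proof.
have q1 := card_field_gt1.
move=> ->; rewrite /entry_dist; case: eqP => _ /=; rewrite ?mulr1n ?mulr0n; field.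
  by rewrite gt_eqF //; lra.
by rewrite !gt_eqF //; lra.
Qed.

(** With probability [rho ^ weight x] all entries meeting the support of [x] are drawn as zero;
    otherwise some uniform entry makes the product uniform. The target [c] is arbitrary because the
    induction fixes the first entry [a] and moves the target to [c - a * x0]. *)
Lemma sum_row_dot (p rho : R) n (x : 'cV[F]_n) (c : F) :
    p = (1 - #|F|%:R^-1) * (1 - rho) ->
  \sum_(v : 'rV_n | (v *m x) 0 0 == c) \prod_j entry_dist p (v 0 j)
  = rho ^+ weight x * (c == 0)%:R + (1 - rho ^+ weight x) / #|F|%:R.
Proof.
move=> hp; elim: n x c => [|n IH] x c.
  rewrite /weight big_ord0 expr0 subrr mul0r addr0 mul1r.
  rewrite big_mkcond (big_pred1 0) /=; last first.
    by move=> v; rewrite (thinmx0 v) [0]thinmx0 /= eqxx.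
  by rewrite big_ord0 mul0mx mxE eq_sym; case: eqP.
pose x0 := x ord0 0; pose x' : 'cV_n := dsubmx (x : 'cV_(1 + n)).
have wx : weight x = ((x0 != 0)%R + weight x')%N.
  rewrite /weight big_ord_recl; congr addn; apply: eq_bigr => i _.
  by rewrite /x' mxE; congr (nat_of_bool (x _ _ != _)); apply/val_inj.
have hdot a v : (rV_cons a v *m x) 0 0 = a * x0 + (v *m x') 0 0.
  rewrite !mxE big_ord_recl rV_cons0; congr (_ + _); apply: eq_bigr => j _.
  by rewrite rV_consS mxE; congr (_ * x _ _); apply/val_inj.
transitivity (\sum_a entry_dist p a *
    (rho ^+ weight x' * (c - a * x0 == 0)%:R + (1 - rho ^+ weight x') / #|F|%:R)).
  rewrite big_mkcond big_rV_recl /=; apply: eq_bigr => a _.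
  rewrite -IH big_distrr [RHS]big_mkcond /=; apply: eq_bigr => v _.
  rewrite hdot /= eq_sym addrC -subr_eq eq_sym; case: ifP => _ //.
  rewrite big_ord_recl rV_cons0; congr (_ * _); apply: eq_bigr => j _. by rewrite rV_consS.
have q1 := card_field_gt1.
have q0 : #|F|%:R != 0 :> R by rewrite gt_eqF //; lra.
rewrite wx; have [x00|x0n] /= := eqVneq x0 0.
  under eq_bigr do rewrite x00 mulr0 subr0.
  by rewrite -big_distrl /= sum_entry_dist mul1r.
under eq_bigr do rewrite mulrDr.
rewrite big_split /= -big_distrl /= sum_entry_dist mul1r.
rewrite (bigD1 (c / x0)) //= [X in _ + X + _]big1 ?addr0; last first.
  move=> a /eqP hne; case: eqP => [/eqP|_]; last by rewrite !mulr0.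
  by rewrite subr_eq0 => /eqP e; case: hne; rewrite e mulfK.
rewrite divfK // subrr eqxx (entry_dist_mix _ hp) mulf_eq0 invr_eq0 (negbTE x0n) orbF.
by rewrite add1n exprS /= mulr1n mulr1; field.
Qed.

End EntryDist.

(** * The union bound *)

(** The weight enumerator of [F^k]: each coordinate contributes 1 for zero and [c] for each of the
    [#|F| - 1] units. *)
Lemma sum_exp_weight (R : comPzRingType) (F : finFieldType) (k : nat) (c : R) :
  \sum_(y : 'cV[F]_k) c ^+ weight y = (1 + (#|F|%:R - 1) * c) ^+ k.
Proof.
have -> : (1 + (#|F|%:R - 1) * c) ^+ k
    = \prod_(i < k) \sum_(a : F) c ^+ (a != 0)%R.
  rewrite prodr_const card_ord; congr (_ ^+ _).
  rewrite (bigD1 0) //= eqxx expr0; congr (_ + _).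
  rewrite (eq_bigr (fun=> c)) => [|a ->]; last by rewrite expr1.
  rewrite sumr_const; set N := #|_|.
  have -> : N = #|F|.-1 by rewrite -(cardC1 (0 : F)).
  rewrite -[#|F| in LHS]prednK 1?ltnW ?card_finNzRing_gt1 //.
  by rewrite -addn1 natrD addrK mulr_natl.
rewrite -sum_rV_prod (reindex (@trmx F 1 k)) /=; last first.
  by exists (@trmx F k 1) => x _; rewrite trmxK.
apply: eq_bigr => y _; rewrite /weight expr_sum.
by apply: eq_bigr => i _; rewrite mxE.
Qed.

Lemma sum_annihilator (R : realFieldType) (F : finFieldType) (p rho : R)
    (l n : nat) (x : 'cV[F]_n) :
    p = (1 - #|F|%:R^-1) * (1 - rho) ->
  \sum_(M : 'M_(l, n) | M *m x == 0) mx_dist p M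
  = ((1 + (#|F|%:R - 1) * rho ^+ weight x) / #|F|%:R) ^+ l.
Proof.
move=> hp; have q1 := card_field_gt1 R F.
pose f (i : 'I_l) (v : 'rV[F]_n) : R :=
  if (v *m x) 0 0 == 0 then \prod_j entry_dist p (v 0 j) else 0.
transitivity (\sum_(M : 'M_(l, n)) \prod_i f i (row i M)).
  rewrite big_mkcond /=; apply: eq_bigr => M _.
  case: eqP => [M0|/eqP M0].
    apply: eq_bigr => i _; rewrite /f -row_mul M0 !mxE eqxx.
    by apply: eq_bigr => j _; rewrite mxE.
  have /existsP[i hi] : [exists i, (M *m x) i 0 != 0].
    apply: contraR M0; rewrite negb_exists => /forallP h.
    by apply/eqP/colP => i; rewrite [RHS]mxE; apply/eqP; have := h i; rewrite negbK.
  by rewrite (bigD1 i) //= /f -row_mul [row _ _ _ _]mxE (negbTE hi) mul0r.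
rewrite sum_mx_rows -[X in _ ^+ X]card_ord -prodr_const.
apply: eq_bigr => i _; rewrite -big_mkcond /= (sum_row_dot _ _ hp) eqxx mulr1n mulr1.
by field; rewrite gt_eqF //; lra.
Qed.

(** The coordinates of [Z *m y] at the positions [f] are those of [y], and [f] repeats no
    position. *)
Lemma weight_mulmx (F : finFieldType) (n k : nat) (Z : 'M[F]_(n, k))
    (f : 'I_k -> 'I_n) (y : 'cV_k) :
  injective f -> rowsub f Z = 1%:M -> (weight y <= weight (Z *m y))%N.
Proof.
move=> finj fZ; have fy i : (Z *m y) (f i) 0 = y i 0.
  by rewrite -[in RHS](mul1mx y) -fZ mul_rowsub_mx [RHS]mxE.
rewrite /weight (eq_bigr (fun i => ((Z *m y) (f i) 0 != 0)%R : nat)); last first.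
  by move=> i _; rewrite fy.
rewrite -(big_imset (fun j => ((Z *m y) j 0 != 0)%R : nat)) /=; last exact: in2W.
by rewrite [leqRHS](bigID [in [set f x | x in predT]]) /= leq_addr.
Qed.

Lemma sum_exists_le (R : numDomainType) (S T : finType) (w : S -> R)
    (P : pred T) (E : S -> pred T) :
    (forall x, 0 <= w x) ->
  \sum_(x | [exists y, P y && E x y]) w x <= \sum_(y | P y) \sum_(x | E x y) w x.
Proof.
move=> w0; rewrite [leRHS](exchange_big_dep predT) //= big_mkcond /=.
apply: ler_sum => x _; case: existsP => [[y /andP[Py Ey]]|_].
  by rewrite (bigD1 y) ?Py //= lerDl sumr_ge0.
by rewrite sumr_ge0.
Qed.

(** Stated as a negated existence, so that its failure is the union of events to which
    [sum_exists_le] applies. *)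
Definition col_injective (F : finFieldType) (l k : nat) (N : 'M[F]_(l, k)) : bool :=
  ~~ [exists y : 'cV_k, (y != 0) && (N *m y == 0)].

Lemma col_injectiveP (F : finFieldType) (l k : nat) (N : 'M[F]_(l, k)) :
  reflect (forall y : 'cV_k, N *m y = 0 -> y = 0) (col_injective N).
Proof.
apply: (iffP idP) => [/existsPn h y /eqP Ny | h].
  by have := h y; rewrite Ny andbT negbK => /eqP.
apply/existsPn => y; rewrite negb_and negbK orbC -implybE.
by apply/implyP => /eqP/h ->.
Qed.

Lemma sum_not_col_injective_le (R : realFieldType) (F : finFieldType)
    (p rho : R) (l n k : nat) (Z : 'M[F]_(n, k)) (f : 'I_k -> 'I_n) :
    0 <= rho <= 1 -> p = (1 - #|F|%:R^-1) * (1 - rho) ->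
    injective f -> rowsub f Z = 1%:M ->
  \sum_(M : 'M_(l, n) | ~~ col_injective (M *m Z)) mx_dist p M
  <= \sum_(y : 'cV[F]_k | y != 0)
        ((1 + (#|F|%:R - 1) * rho ^+ weight y) / #|F|%:R) ^+ l.
Proof.
move=> /andP[r0 r1] hp finj fZ; have q1 := card_field_gt1 R F.
have iq1 : #|F|%:R^-1 <= 1 :> R by rewrite invf_le1 //; lra.
have iq0 : 0 <= #|F|%:R^-1 :> R by rewrite invr_ge0; lra.
have p01 : 0 <= p <= 1.
  rewrite hp mulr_ge0 ?mulr_ile1 //; lra.
rewrite (eq_bigl (fun M : 'M_(l, n) =>
    [exists y : 'cV_k, (y != 0) && (M *m Z *m y == 0)])); last first.
  by move=> M; rewrite negbK.
apply: (le_trans (sum_exists_le _ _ _)) => [M|]; first exact: mx_dist_ge0.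
apply: ler_sum => y _; under eq_bigl do rewrite -mulmxA.
rewrite (sum_annihilator _ _ hp) lerXn2r ?nnegrE ?mulr_ge0 ?addr_ge0 ?mulr_ge0 ?exprn_ge0 //; try lra.
rewrite ler_wpM2r // lerD2l ler_wpM2l //; first lra.
by rewrite ler_wiXn2l // (weight_mulmx _ finj fZ).
Qed.

(** The columns of [Z] are a basis of the kernel of [A], normalized by inverting a nonsingular block
    of [k] rows; [f] lists these rows. *)
Lemma kernel_parametrization (F : finFieldType) (m n k : nat) (A : 'M[F]_(m, n)) :
    (m <= n)%N -> (n - m)%N = k -> \rank A = m ->
  exists (Z : 'M[F]_(n, k)) (f : 'I_k -> 'I_n),
    [/\ injective f, rowsub f Z = 1%:M
      & forall l (M : 'M_(l, n)), col_injective (M *m Z) ->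
          \rank (col_mx A M) = n].
Proof.
move=> hmn hk rA.
have {hk} : \rank (kermx A^T) = k by rewrite mxrank_ker mxrank_tr rA.
(* Replacing [k] by the rank of the kernel gives [U] the right number of rows by conversion. *)
case: k / => /=; set U := row_base (kermx A^T).
have Ufull : row_full U^T by rewrite /row_full mxrank_tr; exact: row_base_free.
pose f := fullrankfun Ufull; pose C := rowsub f U^T.
have Cunit : C \in unitmx by exact: fullrowsub_unit.
exists (U^T *m invmx C), f; split.
- exact: fullrankfun_inj.
- by rewrite -mul_rowsub_mx mulmxV.
- move=> l M /col_injectiveP inj.
  (* A vector killed by both [A] and [M] lies in the kernel of [A], hence is [Z] times a vector
     which [M *m Z] kills. *)
  rewrite -mxrank_tr; apply/eqP/inj_row_free => v.
  rewrite tr_col_mx mul_mx_row -[0]hsubmxK => /eq_row_mx[].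
  rewrite !linear0 => vA vM.
  have /submxP[D vD] : (v <= U)%MS by rewrite eq_row_base sub_kermx vA.
  have vE : v^T = U^T *m invmx C *m (C *m D^T).
    by rewrite -mulmxA mulKmx // vD trmx_mul.
  have := inj (C *m D^T); rewrite -mulmxA -vE -[M]trmxK -trmx_mul vM trmx0.
  move=> /(_ erefl) CD; apply: trmx_inj.
  by rewrite vE CD mulmx0 trmx0.
Qed.

(** * Matchings and large fields *)

(** The determinant is affine in its corner entry: the cofactors along the first row do not involve
    that row. *)
Lemma det_shift_corner (R : comPzRingType) (k : nat) (A B : 'M[R]_k.+1) :
    row' ord0 A = row' ord0 B ->
    (forall j, j != ord0 -> A ord0 j = B ord0 j) ->
  \det A = \det B + (A ord0 ord0 - B ord0 ord0) * \det (row' ord0 (col' ord0 B)).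
Proof.
move=> hrow h0.
have hcof j : cofactor A ord0 j = cofactor B ord0 j.
  rewrite /cofactor; congr (_ * \det _).
  by apply/matrixP => r s; have /matrixP/(_ r (lift j s)) := hrow; rewrite !mxE.
rewrite (expand_det_row A ord0) (expand_det_row B ord0).
rewrite (bigD1 ord0) //= [in RHS](bigD1 ord0) //= !hcof.
under eq_bigr => j hj do rewrite h0 // hcof.
have -> : \det (row' ord0 (col' ord0 B)) = cofactor B ord0 ord0.
  by rewrite /cofactor addn0 expr0 mul1r.
by ring.
Qed.

Definition all_nz (R : pzSemiRingType) (F : finFieldType) (k : nat) (x : 'rV[F]_k) : R :=
  \prod_i (x 0 i != 0)%:R.

Lemma all_nz_ge0 (R : realFieldType) (F : finFieldType) (k : nat) (x : 'rV[F]_k) :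
  0 <= all_nz R x.
Proof. by apply: prodr_ge0 => i _; rewrite ler0n. Qed.

Lemma all_nz_cons (R : comPzSemiRingType) (F : finFieldType) (k : nat) (a : F)
    (x : 'rV[F]_k) :
  all_nz R (rV_cons a x) = (a != 0)%:R * all_nz R x.
Proof.
rewrite /all_nz big_ord_recl rV_cons0; congr (_ * _); apply: eq_bigr => i _.
by rewrite rV_consS.
Qed.

Lemma sum_nz (R : realFieldType) (F : finFieldType) :
  \sum_(a : F) (a != 0)%:R = #|F|%:R - 1 :> R.
Proof.
rewrite -[RHS](sum_entry_dist_nz F (#|F|%:R - 1 : R)).
rewrite [RHS]big_mkcond /=; apply: eq_bigr => a _.
rewrite /entry_dist; case: eqP => //= _; rewrite divff // subr_eq0 gt_eqF //.
exact: card_field_gt1.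
Qed.

Lemma sum_all_nz (R : realFieldType) (F : finFieldType) (k : nat) :
  \sum_(x : 'rV[F]_k) all_nz R x = (#|F|%:R - 1) ^+ k.
Proof.
rewrite /all_nz (sum_rV_prod (fun _ a => (a != 0)%:R)).
by under eq_bigr do rewrite sum_nz; rewrite prodr_const card_ord.
Qed.

(** A Schwartz-Zippel argument over the units, one coordinate of [x] at a time: a random unit
    diagonal makes the matrix singular with probability at most [k / (#|F| - 1)]. The denominators
    are cleared. *)
Lemma sum_singular_diag_le (R : realFieldType) (F : finFieldType) (k : nat)
    (a : 'I_k -> F) (C : 'M[F]_k) :
    (forall i, a i != 0) ->
  (#|F|%:R - 1) * \sum_(x : 'rV[F]_k) all_nz R x *
      (\det (diag_mx (\row_i (x 0 i * a i)) + C) == 0)%:R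
  <= k%:R * (#|F|%:R - 1) ^+ k.
Proof.
have c0 : 0 < #|F|%:R - 1 :> R by rewrite subr_gt0 card_field_gt1.
elim: k a C => [|k IH] a C an0.
  rewrite mul0r big1 ?mulr0 // => x _.
  by rewrite [diag_mx _ + C]flatmx0 det_mx00 oner_eq0 mulr0.
pose a' i := a (lift ord0 i); pose C' := row' ord0 (col' ord0 C).
pose D (x : 'rV[F]_k.+1) : 'M_k.+1 := diag_mx (\row_i (x 0 i * a i)) + C.
pose D' (x : 'rV[F]_k) : 'M_k := diag_mx (\row_i (x 0 i * a' i)) + C'.
have DE x i j : D x i j = (x 0 i * a i) *+ (i == j) + C i j by rewrite !mxE.
have DD x0 y0 x : \det (D (rV_cons x0 x)) =
    \det (D (rV_cons y0 x)) + (x0 - y0) * a ord0 * \det (D' x).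
  rewrite (@det_shift_corner _ _ _ (D (rV_cons y0 x))); first last.
  - by move=> j j0; rewrite !DE eq_sym (negbTE j0).
  - by apply/matrixP => i j; rewrite [LHS]mxE [RHS]mxE !DE !rV_consS.
  congr (_ + _ * _).
    by rewrite !DE !rV_cons0 eqxx !mulr1n; ring.
  congr (\det _); apply/matrixP => i j; rewrite [LHS]mxE [LHS]mxE DE rV_consS.
  by rewrite (inj_eq lift_inj) !mxE.
(* If the minor [D' x] is singular, every unit [x0] is counted; otherwise the determinant is affine
   in [x0] with nonzero slope and has at most one root. *)
have one x : all_nz R x * \sum_x0 (x0 != 0)%:R * (\det (D (rV_cons x0 x)) == 0)%:R
    <= (#|F|%:R - 1) * (all_nz R x * (\det (D' x) == 0)%:R) + all_nz R x.
  rewrite mulrCA -[X in _ <= _ + X]mulr1 -mulrDr ler_wpM2l ?all_nz_ge0 //.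
  have [d0|dn0] := eqVneq (\det (D' x)) 0.
    rewrite mulr1 -sum_nz; apply: ler_wpDr => //; apply: ler_sum => b _.
    by rewrite ler_piMr ?ler0n // lern1 leq_b1.
  rewrite mulr0 add0r.
  apply: (@le_trans _ _ (\sum_x0 (\det (D (rV_cons x0 x)) == 0)%:R)).
    by apply: ler_sum => b _; rewrite ler_piMl ?ler0n // lern1 leq_b1.
  have [y0 /eqP hy0|no] := pickP (fun x0 => \det (D (rV_cons x0 x)) == 0); last first.
    by rewrite big1 // => b _; have /= -> := no b.
  rewrite (bigD1 y0) //= hy0 eqxx big1 ?addr0 // => b by0.
  rewrite (DD b y0) hy0 add0r !mulf_eq0 subr_eq0 (negbTE by0) (negbTE dn0).
  by rewrite (negbTE (an0 _)).
rewrite big_rV_recl exchange_big /=.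
apply: (@le_trans _ _ ((#|F|%:R - 1) * \sum_(x : 'rV[F]_k)
   ((#|F|%:R - 1) * (all_nz R x * (\det (D' x) == 0)%:R) + all_nz R x))).
  rewrite ler_pM2l //; apply: ler_sum => x _; apply: le_trans (one x).
  rewrite mulr_sumr; apply: ler_sum => b _.
  by rewrite all_nz_cons -/(D _) mulrCA mulrA.
rewrite big_split /= sum_all_nz -mulr_sumr mulrDr -natr1 [leRHS]mulrDl mul1r -exprS.
rewrite lerD2r exprS [leRHS]mulrCA ler_pM2l //.
by have := IH a' C'; apply => i; exact: an0.
Qed.

(** * Zero patterns, matchings and rescalings *)

Definition support_mx (F : finFieldType) (l n : nat) (M : 'M[F]_(l, n)) : 'M[bool]_(l, n) :=
  map_mx (fun a => a != 0) M.

Definition is_matching (l n k : nat) (f : 'I_k -> 'I_n) (B : 'M[bool]_(l, n))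
    (g : {ffun 'I_k -> 'I_l}) : bool :=
  injectiveb g && [forall t, B (g t) (f t)].

Definition has_matching (l n k : nat) (f : 'I_k -> 'I_n) (B : 'M[bool]_(l, n)) : bool :=
  [exists g, is_matching f B g].

(** The right side does not mention [F], which allows two fields to be compared at the same [p]. *)
Lemma sum_mx_dist_support (R : realFieldType) (F : finFieldType) (p : R)
    (l n : nat) (P : pred 'M[bool]_(l, n)) :
  \sum_(M : 'M[F]_(l, n) | P (support_mx M)) mx_dist p M
  = \sum_(B | P B) \prod_i \prod_j (if B i j then p else 1 - p).
Proof.
rewrite (partition_big (@support_mx F l n) P) //=; apply: eq_bigr => B PB.
have E a : \sum_(c : F) entry_dist p c * ((c != 0) == a)%:R = if a then p else 1 - p.
  case: a; last first.
    rewrite (bigD1 0) //= eqxx mulr1 big1 ?addr0 /entry_dist ?eqxx // => c ->.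
    by rewrite mulr0.
  rewrite -[RHS](sum_entry_dist_nz F p) [RHS]big_mkcond /=; apply: eq_bigr => c _.
  by case: (c == 0); rewrite ?mulr1 ?mulr0.
transitivity (\sum_(M : 'M[F]_(l, n)) \prod_i \prod_j
    (entry_dist p (M i j) * ((M i j != 0) == B i j)%:R)).
  rewrite big_mkcond /=; apply: eq_bigr => M _.
  under [RHS]eq_bigr do rewrite big_split /=.
  rewrite big_split /= -/(mx_dist p M).
  have [eB|neB] := eqVneq (support_mx M) B.
    rewrite eB PB /= [X in _ * X]big1 ?mulr1 // => i _; rewrite big1 // => j _.
    by rewrite -eB mxE eqxx.
  rewrite andbF; have /existsP[i /existsP[j hij]] :
      [exists i, exists j, (M i j != 0) != B i j].
    apply: contraR neB; rewrite negb_exists => /forallP h.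
    apply/eqP/matrixP => i j; rewrite mxE.
    by have := h i; rewrite negb_exists => /forallP/(_ j); rewrite negbK => /eqP.
  by rewrite [X in _ * X](bigD1 i) //= (bigD1 j) //= (negbTE hij) !mul0r mulr0.
rewrite (sum_mx_prod (fun i j c => entry_dist p c * ((c != 0) == B i j)%:R)).
by do 2![apply: eq_bigr => ? _]; rewrite E.
Qed.

(** Full column rank gives a nonzero maximal minor, whose Leibniz expansion has a nonzero term; its
    permutation is the matching. *)
Lemma has_matching_support (F : finFieldType) (l n k : nat) (f : 'I_k -> 'I_n)
    (M : 'M[F]_(l, n)) :
  col_injective (M *m (\matrix_(c, t) (c == f t)%:R)) ->
  has_matching f (support_mx M).
Proof.
set N := M *m _ => /col_injectiveP inj.
have NE i t : N i t = M i (f t).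
  rewrite mxE (bigD1 (f t)) //= mxE eqxx mulr1 big1 ?addr0 // => c /negbTE h.
  by rewrite mxE h mulr0.
have Nfull : row_full N.
  rewrite /row_full -mxrank_tr; apply: inj_row_free => v vN.
  by apply: trmx_inj; rewrite trmx0; apply: inj; rewrite -[N]trmxK -trmx_mul vN trmx0.
have [g0 g0inj] : exists2 g0 : 'I_k -> 'I_l, injective g0 & rowsub g0 N \in unitmx.
  by exists (fullrankfun Nfull); [exact: fullrankfun_inj | exact: fullrowsub_unit].
rewrite unitmxE unitfE => det_nz.
have /existsP[s hs] : [exists s : 'S_k, \prod_i N (g0 i) (s i) != 0].
  apply: contraR det_nz; rewrite negb_exists => /forallP h.
  apply/eqP; rewrite /determinant big1 // => s _.
  have := h s; rewrite negbK => /eqP E.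
  by under eq_bigr do rewrite mxE; rewrite E mulr0.
apply/existsP; exists [ffun t => g0 (s^-1 t)%g]; apply/andP; split.
  apply/injectiveP => t t'; by rewrite !ffunE => /g0inj/perm_inj.
apply/forallP => t; rewrite ffunE mxE -NE -[X in N _ X](permKV s).
by move/prodf_neq0: hs; apply.
Qed.

(** For injective [g] at most one factor of the product differs from 1, and the entry at
    [(g t, f t)] is multiplied by [x 0 t]. Taking [x = 0] erases the matched entries. *)
Definition rescale (F : finFieldType) (l n k : nat) (f : 'I_k -> 'I_n)
    (g : 'I_k -> 'I_l) (x : 'rV[F]_k) (M : 'M[F]_(l, n)) : 'M[F]_(l, n) :=
  \matrix_(i, j) ((\prod_t (if (g t == i) && (f t == j) then x 0 t else 1)) * M i j).

Section Rescale.
Variables (F : finFieldType) (l n k : nat) (f : 'I_k -> 'I_n) (g : 'I_k -> 'I_l).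
Implicit Types (x : 'rV[F]_k) (M : 'M[F]_(l, n)).

Lemma rescale_inj x : (forall t, x 0 t != 0) -> injective (rescale f g x).
Proof.
move=> x0 M M' /matrixP h; apply/matrixP => i j; have := h i j; rewrite !mxE.
by apply: mulfI; apply/prodf_neq0 => t _; case: ifP; rewrite ?oner_eq0.
Qed.

Lemma rescale_eq0 x M i j :
  (forall t, x 0 t != 0) -> (rescale f g x M i j == 0) = (M i j == 0).
Proof.
move=> x0; rewrite mxE mulf_eq0; case: eqP => //= /eqP.
by move/prodf_eq0 => [t _]; case: ifP; rewrite ?oner_eq0 ?(negbTE (x0 _)).
Qed.

Lemma support_rescale x M :
  (forall t, x 0 t != 0) -> support_mx (rescale f g x M) = support_mx M.
Proof.
by move=> x0; apply/matrixP => i j; rewrite ![support_mx _ i j]mxE rescale_eq0.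
Qed.

Lemma mx_dist_rescale (R : realFieldType) (p : R) x M :
  (forall t, x 0 t != 0) -> mx_dist p (rescale f g x M) = mx_dist p M.
Proof.
move=> x0; do 2![apply: eq_bigr => ? _].
by rewrite /entry_dist rescale_eq0.
Qed.

(** Row [f t] of [Z] is a unit vector, so the matched entry of row [g t] reaches only the diagonal;
    the other term is independent of [x]. *)
Lemma rowsub_rescale (Z : 'M[F]_(n, k)) x M :
    injective g -> rowsub f Z = 1%:M ->
  rowsub g (rescale f g x M *m Z)
  = diag_mx (\row_t (x 0 t * M (g t) (f t))) + rowsub g (rescale f g 0 M *m Z).
Proof.
move=> ginj fZ; have rE (y : 'rV_k) t j : rescale f g y M (g t) j =
    (if f t == j then y 0 t else 1) * M (g t) j.
  rewrite mxE (bigD1 t) //= eqxx big1 ?mulr1 // => t' t't.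
  by rewrite (inj_eq ginj) (negbTE t't).
have sE (y : 'rV_k) t u : rowsub g (rescale f g y M *m Z) t u =
    (y 0 t * M (g t) (f t)) *+ (t == u) + \sum_(j | j != f t) M (g t) j * Z j u.
  rewrite [LHS]mxE mxE (bigD1 (f t)) //= rE eqxx; congr (_ + _).
    by have /matrixP/(_ t u) := fZ; rewrite !mxE => ->; rewrite mulr_natr.
  by apply: eq_bigr => j jt; rewrite rE eq_sym (negbTE jt) mul1r.
apply/matrixP => t u; rewrite sE [RHS]mxE sE !mxE !mul0r mul0rn add0r.
by case: eqP => [->|].
Qed.

End Rescale.

(* The laws of [M] and of its rescaling by a unit vector [x] agree, so it suffices
   to average over [x] for each fixed [M]. *)
Lemma sum_matching_singular_le (R : realFieldType) (F : finFieldType) (p : R)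
    (l n k : nat) (Z : 'M[F]_(n, k)) (f : 'I_k -> 'I_n) :
    0 <= p <= 1 -> rowsub f Z = 1%:M ->
  \sum_(M : 'M[F]_(l, n) | has_matching f (support_mx M) && ~~ col_injective (M *m Z))
     mx_dist p M
  <= k%:R / (#|F|%:R - 1).
Proof.
move=> p01 fZ; have c0 : 0 < #|F|%:R - 1 :> R by rewrite subr_gt0 card_field_gt1.
(* The chosen matching depends on the support only, so rescaling by units preserves each class
   [pk M = Some g]. *)
pose pk (M : 'M[F]_(l, n)) := [pick g | is_matching f (support_mx M) g].
have one g : \sum_(M : 'M[F]_(l, n) | (pk M == Some g) && ~~ col_injective (M *m Z))
    mx_dist p M <= k%:R / (#|F|%:R - 1) * \sum_(M | pk M == Some g) mx_dist p M.
  pose r (x : 'rV[F]_k) (M : 'M[F]_(l, n)) := rescale f g x M.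
  pose E (x : 'rV[F]_k) := \sum_(M | (pk M == Some g) && ~~ col_injective (r x M *m Z))
    mx_dist p M.
  have resc x : all_nz R x != 0 -> E x =
      \sum_(M : 'M[F]_(l, n) | (pk M == Some g) && ~~ col_injective (M *m Z)) mx_dist p M.
    move=> /prodf_neq0 nz; have x0 t : x 0 t != 0.
      by have := nz t isT; rewrite pnatr_eq0; rewrite eqb0 negbK.
    rewrite [RHS](reindex (r x)) /=; last exact: onW_bij (injF_bij (rescale_inj x0)).
    apply: eq_big => [M|M _]; last by rewrite mx_dist_rescale.
    by rewrite /pk support_rescale.
  set S := (X in _ <= _ * X).
  (* The factor [(#|F| - 1) ^ k] counts the vectors [x] without zero entries and turns the left side
     into a sum of the equal terms [E x]. *)
  rewrite -(ler_pM2l c0) -(ler_pM2l (exprn_gt0 k c0)) [leLHS]mulrCA.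
  have -> : (#|F|%:R - 1) ^+ k * ((#|F|%:R - 1) * (k%:R / (#|F|%:R - 1) * S))
      = k%:R * (#|F|%:R - 1) ^+ k * S by field; rewrite gt_eqF.
  have -> : (#|F|%:R - 1) ^+ k * (\sum_(M : 'M[F]_(l, n) |
      (pk M == Some g) && ~~ col_injective (M *m Z)) mx_dist p M)
      = \sum_(M | pk M == Some g) mx_dist p M *
          \sum_x all_nz R x * (~~ col_injective (r x M *m Z))%:R.
    rewrite -sum_all_nz mulr_suml.
    rewrite (eq_bigr (fun x => \sum_(M | pk M == Some g)
       mx_dist p M * (all_nz R x * (~~ col_injective (r x M *m Z))%:R))); last first.
      move=> x _; have [->|nz] := eqVneq (all_nz R x) 0.
        by rewrite mul0r big1 // => M _; rewrite mul0r mulr0.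
      rewrite -(resc x nz) /E big_mkcondr mulr_sumr; apply: eq_bigr => M _.
      by case: ifP => _; rewrite ?mulr1 ?mulr0 1?mulrC.
    by rewrite exchange_big; apply: eq_bigr => M _; rewrite mulr_sumr.
  rewrite /S !mulr_sumr; apply: ler_sum => M /eqP pkM.
  rewrite mulrCA [leRHS]mulrC ler_wpM2l ?mx_dist_ge0 //.
  have /andP[/injectiveP ginj /forallP gnz] : is_matching f (support_mx M) g.
    by move: pkM; rewrite /pk; case: pickP => // h + [<-].
  pose C := rowsub g (rescale f g 0 M *m Z).
  have an0 t : M (g t) (f t) != 0 by have := gnz t; rewrite mxE.
  apply: le_trans (sum_singular_diag_le R C an0); rewrite ler_pM2l //.
  apply: ler_sum => x _; rewrite ler_wpM2l ?all_nz_ge0 // ler_nat.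
  rewrite -(rowsub_rescale _ _ ginj fZ) -/(r x M).
  case: (boolP (col_injective _)) => //= /negP ninj; case: eqP => // /eqP dn0.
  case: ninj; apply/col_injectiveP => y My.
  have : rowsub g (r x M *m Z) *m y = 0 by rewrite mul_rowsub_mx My; apply/matrixP => i j; rewrite !mxE.
  move/(congr1 (mulmx (invmx (rowsub g (r x M *m Z))))); rewrite mulKmx ?mulmx0 //.
  by rewrite unitmxE unitfE.
have pkE M : has_matching f (support_mx M) = (pk M != None).
  rewrite /has_matching /pk; case: pickP => [g hg|no]; first by apply/existsP; exists g.
  by apply/existsP => -[g]; rewrite no.
rewrite (eq_bigl (fun M => (pk M != None) && ~~ col_injective (M *m Z))); last first.
  by move=> M; rewrite pkE.
rewrite (partition_big pk (fun o => o != None)) => [|M /andP[]] //=.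
apply: (@le_trans _ _ (\sum_(o | o != None)
    k%:R / (#|F|%:R - 1) * \sum_(M | pk M == o) mx_dist p M)).
  apply: ler_sum => -[g _|//]; apply: le_trans (one g).
  rewrite le_eqVlt; apply/orP; left; apply/eqP; apply: eq_bigl => M.
  by case: (pk M =P Some g) => [->|]; rewrite ?andbT ?andbF.
rewrite -mulr_sumr ler_piMr ?divr_ge0 ?ler0n ?(ltW c0) //.
rewrite -(sum_mx_dist F p l n) [leRHS](partition_big pk predT) //=.
by rewrite [leLHS]big_mkcond; apply: ler_sum => o _; case: ifP => // _; apply: sumr_ge0 => M _; apply: mx_dist_ge0.
Qed.

(** * Estimates for the union bound *)

Lemma weight0 (F : finFieldType) (k : nat) : weight (0 : 'cV[F]_k) = 0%N.
Proof. by rewrite /weight big1 // => i _; rewrite mxE eqxx. Qed.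

Lemma weight_gt0 (F : finFieldType) (k : nat) (y : 'cV[F]_k) :
  y != 0 -> (0 < weight y)%N.
Proof.
apply: contraR; rewrite -leqNgt leqn0 sum_nat_eq0 => /forallP h.
by apply/eqP/colP => i; rewrite [RHS]mxE; apply/eqP; have := h i; rewrite eqb0 negbK.
Qed.

Lemma weight_le (F : finFieldType) (k : nat) (y : 'cV[F]_k) : (weight y <= k)%N.
Proof.
rewrite -[leqRHS]card_ord -sum1_card; apply: leq_sum => i _; exact: leq_b1.
Qed.

(** The three summands serve light, intermediate and heavy vectors; each is summed over all of [F^k]
    by the weight enumerator. The [- 1] removes the zero vector. *)
Lemma sum_nz_weight_le (R : realFieldType) (F : finFieldType) (k : nat)
    (G : nat -> R) (a c d e : R) :
    0 <= c -> 0 <= d -> 0 <= e ->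
    (forall j, (0 < j <= k)%N -> G j <= a ^+ j + c * d ^+ j + e) ->
  \sum_(y : 'cV[F]_k | y != 0) G (weight y)
  <= ((1 + (#|F|%:R - 1) * a) ^+ k - 1) + c * (1 + (#|F|%:R - 1) * d) ^+ k
     + e * #|F|%:R ^+ k.
Proof.
move=> c0 d0 e0 hG.
apply: (@le_trans _ _ (\sum_(y : 'cV[F]_k | y != 0)
   (a ^+ weight y + (c * d ^+ weight y + e)))).
  by apply: ler_sum => y y0; rewrite addrA hG // weight_gt0 // weight_le.
rewrite big_split /= -addrA lerD //.
  rewrite -sum_exp_weight [in leRHS](bigD1 0) //= weight0 expr0.
  by rewrite addrAC subrr add0r.
rewrite -sum_exp_weight mulr_sumr.
have -> : e * #|F|%:R ^+ k = \sum_(y : 'cV[F]_k) e.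
  by rewrite sumr_const card_mx muln1 -[RHS]mulr_natr natrX.
rewrite -big_split /= [leRHS](bigD1 0) //= lerDr.
by rewrite addr_ge0 // mulr_ge0 // exprn_ge0.
Qed.

(** Induction by [(1 + x) (1 - (k + 1) x) <= 1 - k x]. *)
Lemma expr1D_mul_le1 (R : realFieldType) (x : R) (k : nat) :
  0 <= x -> (1 + x) ^+ k * (1 - k%:R * x) <= 1.
Proof.
move=> x0; elim: k => [|k IH]; first by rewrite mul0r subr0 mulr1.
apply: le_trans IH; rewrite exprSr -mulrA ler_wpM2l ?exprn_ge0 //; first lra.
rewrite -natr1; have : 0 <= k%:R :> R by []; nra.
Qed.

Lemma expr1D_le (R : realFieldType) (x t : R) (k : nat) :
  0 <= x -> k%:R * x <= t -> t < 1 -> (1 + x) ^+ k <= (1 - t)^-1.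
Proof.
move=> x0 kx t1; rewrite -[leRHS]mul1r ler_pdivlMr; last lra.
apply: le_trans (expr1D_mul_le1 k x0); rewrite ler_wpM2l ?exprn_ge0 //; lra.
Qed.

(** * The probability [g j] that a random row annihilates a vector of weight [j] *)

Section ZeroProbBounds.
Variables (R : rcfType) (q rho : R) (k l : nat).
Hypotheses (hrho : 0 <= rho <= 1) (hl : (k <= l)%N).

Let g (j : nat) : R := (1 + (q - 1) * rho ^+ j) / q.

Lemma zero_prob_bounds j : 1 < q -> 0 <= g j <= 1.
Proof.
move=> q1; case/andP: hrho => r0 r1.
have r01 : 0 <= rho ^+ j <= 1 by rewrite exprn_ge0 //= exprn_ile1.
by rewrite /g ler_pdivlMr ?ler_pdivrMr; [nra|lra|lra].
Qed.

Lemma zero_prob_expr_le j c : 1 < q -> g j <= c -> g j ^+ l <= c ^+ k.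
Proof.
move=> q1 gc; have /andP[g0 g1] := zero_prob_bounds j q1.
apply: (@le_trans _ _ (g j ^+ k)); first by rewrite ler_wiXn2l.
by rewrite lerXn2r ?nnegrE // (le_trans g0).
Qed.

Lemma zero_prob_expr_tail j x t : 1 < q -> 0 <= x -> rho ^+ j <= x ->
  l%:R * ((q - 1) * x) <= t -> t < 1 -> g j ^+ l <= (1 - t)^-1 * q^-1 ^+ l.
Proof.
move=> q1 x0 rx lx t1; case/andP: hrho => r0 r1.
rewrite /g exprMn ler_wpM2r ?exprn_ge0 ?invr_ge0 //; first lra.
have rj0 : 0 <= rho ^+ j by rewrite exprn_ge0.
apply: expr1D_le => //; first by rewrite mulr_ge0 //; lra.
by apply: le_trans lx; rewrite ler_wpM2l // ler_wpM2l //; lra.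
Qed.

(* With [w = sqrt rho] and [z = w ^ j]: if [z >= 1 / (q - 1)] then [g j <= z], because
   [q z - 1 - (q - 1) z^2 = (1 - z) ((q - 1) z - 1)]; if [z < 1 / (q - 1)] then
   [g j <= 1 / (q - 1)], which suffices for [2 j <= k]; and if [2 j > k] then
   [rho ^ j] is so small that [g j ^ l] is close to [q ^ -l]. *)
Lemma zero_prob_large_field_le (b : R) j :
    2 <= q -> (96 <= k)%N -> (l <= k + 3)%N -> 60 * (q - 1) <= k%:R ^+ 2 ->
    rho ^+ k <= k%:R ^- 6 -> 1 <= b -> b ^+ 2 = q - 1 -> (0 < j <= k)%N ->
  g j ^+ l <= k%:R ^- 3 ^+ j + b ^- k * b ^- 2 ^+ j + 58 / 57 * q^-1 ^+ l.
Proof.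
move=> q2 k96 lk3 qk rk b1 bq /andP[j0 jk]; have q1 : 1 < q by lra.
case/andP: hrho => r0 r1; have kR : 96 <= k%:R :> R by rewrite ler_nat.
pose w := Num.sqrt rho; have w0 : 0 <= w by rewrite sqrtr_ge0.
have w2 : w ^+ 2 = rho by rewrite sqr_sqrtr.
have wk : w ^+ k <= k%:R ^- 3.
  rewrite -(@ler_pXn2r _ 2) ?nnegrE ?exprn_ge0 ?invr_ge0 ?exprn_ge0 //.
  by rewrite -exprM mulnC exprM w2 exprVn -exprM.
have iq0 : 0 <= q^-1 ^+ l by rewrite exprn_ge0 // invr_ge0; lra.
have A0 : 0 <= k%:R ^- 3 ^+ j :> R by rewrite exprn_ge0 // invr_ge0 exprn_ge0.
have ib i : 0 <= b ^- i by rewrite invr_ge0 exprn_ge0 //; lra.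
have B0 : 0 <= b ^- k * b ^- 2 ^+ j by rewrite mulr_ge0 ?exprn_ge0.
have C0 : 0 <= 58 / 57 * q^-1 ^+ l by rewrite mulr_ge0 //; lra.
pose z := w ^+ j; have z0 : 0 <= z by rewrite exprn_ge0.
have z1 : z <= 1 by rewrite exprn_ile1 // -(@ler_pXn2r _ 2) ?nnegrE // w2 expr1n.
have rz : rho ^+ j = z ^+ 2 by rewrite -w2 -!exprM mulnC.
have [zq|zq] := leP 1 (z * (q - 1)).
  have gz : g j <= z by rewrite /g rz ler_pdivrMr; [nra|lra].
  have := zero_prob_expr_le q1 gz.
  have : z ^+ k <= k%:R ^- 3 ^+ j.
    by rewrite /z -exprM mulnC exprM lerXn2r ?nnegrE ?exprn_ge0 ?invr_ge0 ?exprn_ge0.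
  by move: A0 B0 C0; lra.
have [jk2|jk2] := leqP (2 * j) k.
  have gz : g j <= b ^- 2.
    rewrite /g rz ler_pdivrMr; last lra.
    rewrite bq [leRHS]mulrC ler_pdivlMr; last lra.
    have : z ^+ 2 * (q - 1) ^+ 2 <= 1 by rewrite -exprMn exprn_ile1 //; nra.
    by nra.
  have := zero_prob_expr_le q1 gz.
  (* Half of the exponent is kept as [b ^- k], because the factor [b ^- 2 ^+ j] sums to only [2 ^ k]
     over all vectors. *)
  have : b ^- 2 ^+ k <= b ^- k * b ^- 2 ^+ j.
    rewrite -!exprVn -!exprM -exprD ler_wiXn2l //; first by rewrite invr_ge0; lra.
      by rewrite invf_le1 //; lra.
    by rewrite [(2 * k)%N]mul2n -addnn leq_add2l.
  by move: A0 B0 C0; lra.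
have rk3 : rho ^+ j <= k%:R ^- 3.
  apply: le_trans wk; rewrite -w2 -exprM ler_wiXn2l //.
    by rewrite -(@ler_pXn2r _ 2) ?nnegrE // w2 expr1n.
  exact: ltnW.
have lR : l%:R <= k%:R + 3 :> R by rewrite -natrD ler_nat.
have k30 : 0 < k%:R ^+ 3 :> R by rewrite exprn_gt0 //; lra.
(* The quotient is at most [(k + 3) / (60 k)], which is at most 99/5760 for [k >= 96]. *)
have T : l%:R * ((q - 1) / k%:R ^+ 3) <= 1 / 58 :> R.
  rewrite mulrA ler_pdivrMr //.
  apply: (@le_trans _ _ ((k%:R + 3) * (q - 1))); first by rewrite ler_wpM2r //; lra.
  apply: (@le_trans _ _ ((k%:R + 3) * (k%:R ^+ 2 / 60))); first by rewrite ler_wpM2l //; lra.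
  by nra.
have x0 : 0 <= k%:R ^- 3 :> R by rewrite invr_ge0 ltW.
have t1 : 1 / 58 < 1 :> R by lra.
have := zero_prob_expr_tail q1 x0 rk3 T t1.
have -> : (1 - 1 / 58)^-1 = 58 / 57 :> R by field.
by move: A0 B0; lra.
Qed.

(* The same three cases with the fourth root [w] of [rho], now based on
   [q z - 1 - (q - 1) z^4 = (1 - z) ((q - 1) (z + z^2 + z^3) - 1)], on the
   threshold [z >= 3/5], and on [8 j <= k] instead of [2 j <= k]. *)
Lemma zero_prob_small_field_le j :
    2 <= q <= 5 -> (41 <= k)%N -> (l <= k + 8)%N ->
    rho ^+ k <= k%:R ^- 16 -> (0 < j <= k)%N ->
  g j ^+ l <= k%:R ^- 4 ^+ j
    + (13 / 10 * ((1 + 13 / 100 * (q - 1)) / q)) ^+ k * (13 / 10) ^- 8 ^+ j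
    + 2 * q^-1 ^+ l.
Proof.
move=> /andP[q2 q5] k41 lk8 rk /andP[j0 jk]; have q1 : 1 < q by lra.
case/andP: hrho => r0 r1; have kR : 41 <= k%:R :> R by rewrite ler_nat.
pose w := Num.sqrt (Num.sqrt rho); have w0 : 0 <= w by rewrite sqrtr_ge0.
have w4 : w ^+ 4 = rho by rewrite (exprM _ 2 2) !sqr_sqrtr ?sqrtr_ge0.
have w1 : w <= 1 by rewrite -(@ler_pXn2r _ 4) ?nnegrE // w4 expr1n.
have wk : w ^+ k <= k%:R ^- 4.
  rewrite -(@ler_pXn2r _ 4) ?nnegrE ?exprn_ge0 ?invr_ge0 ?exprn_ge0 //.
  by rewrite -exprM mulnC exprM w4 exprVn -exprM.
have iq0 : 0 <= q^-1 ^+ l by rewrite exprn_ge0 // invr_ge0; lra.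
have A0 : 0 <= k%:R ^- 4 ^+ j :> R by rewrite exprn_ge0 // invr_ge0 exprn_ge0.
set g1 := (1 + _) / q; have g10 : 0 <= g1 by rewrite divr_ge0; lra.
have B0 : 0 <= (13 / 10 * g1) ^+ k * (13 / 10) ^- 8 ^+ j.
  have b0 : 0 <= 13 / 10 :> R by lra.
  by rewrite mulr_ge0 ?exprn_ge0 ?(mulr_ge0 b0) // invr_ge0 exprn_ge0.
have C0 : 0 <= 2 * q^-1 ^+ l by rewrite mulr_ge0.
pose z := w ^+ j; have z0 : 0 <= z by rewrite exprn_ge0.
have z1 : z <= 1 by rewrite exprn_ile1.
have rz : rho ^+ j = z ^+ 4 by rewrite -w4 -!exprM mulnC.
have [zq|zq] := leP (3 / 5) z.
  have gz : g j <= z.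
    rewrite /g rz ler_pdivrMr; last lra.
    (* At [z = 3/5] the sum [z + z^2 + z^3] is 1.176, so it exceeds 1 even without help from
       [q - 1]. *)
    have z2 : (3 / 5) ^+ 2 <= z ^+ 2 by rewrite lerXn2r ?nnegrE //; lra.
    have z3 : (3 / 5) ^+ 3 <= z ^+ 3 by rewrite lerXn2r ?nnegrE //; lra.
    have s1 : 0 <= (q - 1) * (z + z ^+ 2 + z ^+ 3) - 1 by nra.
    have z1' : 0 <= 1 - z by lra.
    rewrite -subr_ge0.
    have -> : z * q - (1 + (q - 1) * z ^+ 4)
      = (1 - z) * ((q - 1) * (z + z ^+ 2 + z ^+ 3) - 1) by ring.
    exact: mulr_ge0.
  have := zero_prob_expr_le q1 gz.
  have : z ^+ k <= k%:R ^- 4 ^+ j.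
    by rewrite /z -exprM mulnC exprM lerXn2r ?nnegrE ?exprn_ge0 ?invr_ge0 ?exprn_ge0.
  by move: A0 B0 C0; lra.
have [jk8|jk8] := leqP (8 * j) k.
  have gz : g j <= g1.
    have iq : 0 <= q^-1 by rewrite invr_ge0; lra.
    rewrite /g /g1 rz ler_wpM2r //.
    have : z ^+ 4 <= (3 / 5) ^+ 4 by rewrite lerXn2r ?nnegrE //; lra.
    by nra.
  have := zero_prob_expr_le q1 gz.
  (* Since [8 j <= k], the inserted power of 13/10 is at least 1; it makes the bound decay with [j],
     which the sum over vectors needs. The 13/100 in [g1] rounds up [(3/5)^4]. *)
  have : g1 ^+ k <= (13 / 10 * g1) ^+ k * (13 / 10) ^- 8 ^+ j.
    have : 1 < 13 / 10 :> R by lra.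
    move: (13 / 10) => b b1; have b0 : 0 < b by lra.
    rewrite [in leRHS]exprMn [leRHS]mulrAC ler_peMl ?exprn_ge0 // -exprVn -exprM exprVn.
    by rewrite ler_pdivlMr ?exprn_gt0 // mul1r ler_weXn2l // ltW.
  by move: A0 B0 C0; lra.
have rk2 : rho ^+ j <= k%:R ^- 2.
  rewrite -(@ler_pXn2r _ 2) ?nnegrE ?exprn_ge0 ?invr_ge0 ?exprn_ge0 //.
  rewrite exprVn -[in leRHS]exprM; apply: le_trans wk.
  by rewrite -w4 -!exprM ler_wiXn2l // [(j * 2)%N]mulnC mulnA ltnW.
have lR : l%:R <= k%:R + 8 :> R by rewrite -natrD ler_nat.
have T : l%:R * ((q - 1) / k%:R ^+ 2) <= 1 / 2 :> R.
  rewrite mulrA ler_pdivrMr; last by rewrite exprn_gt0 //; lra.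
  apply: (@le_trans _ _ ((k%:R + 8) * 4)); last nra.
  by rewrite ler_pM //; lra.
have x0 : 0 <= k%:R ^- 2 :> R by rewrite invr_ge0 exprn_ge0.
have t1 : 1 / 2 < 1 :> R by lra.
have := zero_prob_expr_tail q1 x0 rk2 T t1.
have -> : (1 - 1 / 2)^-1 = 2 :> R by field.
by move: A0 B0; lra.
Qed.

End ZeroProbBounds.

(** Summed over the vectors, the three terms cost at most 1/59, 1/4096 and 58/(57 * 36), together
    less than 1/20. *)
Lemma sum_zero_prob_large_field (R : rcfType) (F : finFieldType) (rho : R) (k e : nat) :
    (6 <= #|F|)%N -> (96 <= k)%N -> (2 <= e <= 3)%N ->
    (60 * (#|F| - 1) <= k ^ 2)%N -> 0 <= rho <= 1 -> rho ^+ k <= k%:R ^- 6 ->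
  \sum_(y : 'cV[F]_k | y != 0)
    ((1 + (#|F|%:R - 1) * rho ^+ weight y) / #|F|%:R) ^+ (k + e) <= 1 / 20.
Proof.
move=> q6 k96 /andP[e2 e3] qk hrho rk.
have qR : 6 <= #|F|%:R :> R by rewrite ler_nat.
have q0 : #|F|%:R != 0 :> R by rewrite gt_eqF //; lra.
have kR : 96 <= k%:R :> R by rewrite ler_nat.
have qkR : 60 * (#|F|%:R - 1) <= k%:R ^+ 2 :> R.
  have <- : (#|F| - 1)%:R = #|F|%:R - 1 :> R by rewrite natrB // ltnW // card_finNzRing_gt1.
  by rewrite -natrX -natrM ler_nat.
pose b : R := Num.sqrt (#|F|%:R - 1).
have b0 : 0 <= b by rewrite sqrtr_ge0.
have bq : b ^+ 2 = #|F|%:R - 1 by rewrite sqr_sqrtr //; lra.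
have b29 : 20 / 9 <= b by rewrite -(@ler_pXn2r _ 2) ?nnegrE // ?bq; lra.
have b1 : 1 <= b by lra.
have bn0 : b != 0 by rewrite gt_eqF //; lra.
have hG j : (0 < j <= k)%N ->
    ((1 + (#|F|%:R - 1) * rho ^+ j) / #|F|%:R) ^+ (k + e)
    <= k%:R ^- 3 ^+ j + b ^- k * b ^- 2 ^+ j + 58 / 57 * #|F|%:R^-1 ^+ (k + e).
  move=> jk; apply: zero_prob_large_field_le => //; first exact: leq_addr.
    lra.
  by rewrite leq_add2l.
have ib i : 0 <= b ^- i by rewrite invr_ge0 exprn_ge0.
have e0 : 0 <= 58 / 57 * #|F|%:R^-1 ^+ (k + e) :> R.
  by rewrite mulr_ge0 ?exprn_ge0 ?invr_ge0 //; lra.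
apply: le_trans (sum_nz_weight_le F (ib k) (ib 2%N) e0 hG) _.
have E1 : (1 + (#|F|%:R - 1) * k%:R ^- 3) ^+ k - 1 <= 1 / 59 :> R.
  have x0 : 0 <= (#|F|%:R - 1) * k%:R ^- 3 :> R.
    by rewrite mulr_ge0 ?invr_ge0 ?exprn_ge0 //; lra.
  have kx : k%:R * ((#|F|%:R - 1) * k%:R ^- 3) <= 1 / 60 :> R.
    have -> : k%:R * ((#|F|%:R - 1) * k%:R ^- 3) = (#|F|%:R - 1) / k%:R ^+ 2 :> R.
      by field; rewrite gt_eqF //; lra.
    rewrite ler_pdivrMr ?exprn_gt0 //; lra.
  have t1 : 1 / 60 < 1 :> R by lra.
  have := expr1D_le x0 kx t1; have -> : (1 - 1 / 60)^-1 = 60 / 59 :> R by field.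
  lra.
(* As [b ^ 2 = #|F| - 1], this is [(2 / b) ^ k], and [b >= 20/9] makes the base at most 9/10. *)
have E2 : b ^- k * (1 + (#|F|%:R - 1) * b ^- 2) ^+ k <= 1 / 4096.
  rewrite -bq divff ?expf_neq0 // -exprVn -exprMn.
  have v0 : 0 <= b^-1 * (1 + 1) by rewrite mulr_ge0 ?invr_ge0 ?addr_ge0.
  have v9 : b^-1 * (1 + 1) <= 9 / 10 by rewrite mulrC ler_pdivrMr; lra.
  apply: (@le_trans _ _ ((9 / 10) ^+ k)); first by rewrite lerXn2r ?nnegrE //; lra.
  apply: (@le_trans _ _ ((9 / 10) ^+ 96)); first by rewrite ler_wiXn2l //; lra.
  have -> : 1 / 4096 = (1 / 2) ^+ 12 :> R by field.
  rewrite (exprM _ 8 12) lerXn2r ?nnegrE ?exprn_ge0 //; lra.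
have E3 : 58 / 57 * #|F|%:R^-1 ^+ (k + e) * #|F|%:R ^+ k <= 58 / 57 / 36 :> R.
  rewrite exprD mulrA mulrAC -(mulrA (58 / 57)) -exprMn mulVf // expr1n mulr1.
  rewrite ler_wpM2l //; first lra.
  apply: (@le_trans _ _ (6^-1 ^+ e)).
    by rewrite lerXn2r ?nnegrE ?invr_ge0 ?lef_pV2 ?posrE //; lra.
  apply: (@le_trans _ _ (6^-1 ^+ 2)); last lra.
  by rewrite ler_wiXn2l //; lra.
by move: E1 E2 E3; lra.
Qed.

Lemma sum_zero_prob_small_field (R : rcfType) (F : finFieldType) (rho : R) (k e : nat) :
    (#|F| <= 5)%N -> (41 <= k)%N -> (e <= 8)%N -> (243 <= #|F| ^ e)%N ->
    0 <= rho <= 1 -> rho ^+ k <= k%:R ^- 16 ->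
  \sum_(y : 'cV[F]_k | y != 0)
    ((1 + (#|F|%:R - 1) * rho ^+ weight y) / #|F|%:R) ^+ (k + e) <= 1 / 20.
Proof.
move=> q5 k41 e8 qe hrho rk.
have qR2 : 2 <= #|F|%:R :> R by rewrite ler_nat card_finNzRing_gt1.
have qR5 : #|F|%:R <= 5 :> R by rewrite ler_nat.
have q0 : #|F|%:R != 0 :> R by rewrite gt_eqF //; lra.
have kR : 41 <= k%:R :> R by rewrite ler_nat.
have hG j : (0 < j <= k)%N ->
    ((1 + (#|F|%:R - 1) * rho ^+ j) / #|F|%:R) ^+ (k + e)
    <= k%:R ^- 4 ^+ j
      + (13 / 10 * ((1 + 13 / 100 * (#|F|%:R - 1)) / #|F|%:R)) ^+ k * (13 / 10) ^- 8 ^+ j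
      + 2 * #|F|%:R^-1 ^+ (k + e).
  move=> jk; apply: zero_prob_small_field_le => //; first exact: leq_addr.
    by rewrite qR2.
  by rewrite leq_add2l.
set v := 13 / 10 * _ in hG.
have v0 : 0 <= v by rewrite mulr_ge0 ?divr_ge0 //; lra.
have d0 : 0 <= (13 / 10) ^- 8 :> R by rewrite invr_ge0 exprn_ge0 //; lra.
have e0 : 0 <= 2 * #|F|%:R^-1 ^+ (k + e) :> R.
  by rewrite mulr_ge0 ?exprn_ge0 ?invr_ge0 //; lra.
apply: le_trans (sum_nz_weight_le F (exprn_ge0 k v0) d0 e0 hG) _.
have E1 : (1 + (#|F|%:R - 1) * k%:R ^- 4) ^+ k - 1 <= 1 / 1000 :> R.
  have x0 : 0 <= (#|F|%:R - 1) * k%:R ^- 4 :> R.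
    by rewrite mulr_ge0 ?invr_ge0 ?exprn_ge0 //; lra.
  have kx : k%:R * ((#|F|%:R - 1) * k%:R ^- 4) <= 1 / 1001 :> R.
    have -> : k%:R * ((#|F|%:R - 1) * k%:R ^- 4) = (#|F|%:R - 1) / k%:R ^+ 3 :> R.
      by field; rewrite gt_eqF //; lra.
    have k3 : 41 ^+ 3 <= k%:R ^+ 3 :> R by rewrite lerXn2r ?nnegrE //; lra.
    by rewrite ler_pdivrMr ?exprn_gt0 //; lra.
  have t1 : 1 / 1001 < 1 :> R by lra.
  have := expr1D_le x0 kx t1; have -> : (1 - 1 / 1001)^-1 = 1001 / 1000 :> R by field.
  lra.
have E2 : v ^+ k * (1 + (#|F|%:R - 1) * (13 / 10) ^- 8) ^+ k <= 1 / 1024.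
  have d8 : (13 / 10) ^- 8 <= 1 / 8 :> R by lra.
  rewrite -exprMn; set u := v * _.
  have u0 : 0 <= u by rewrite mulr_ge0 // addr_ge0 // mulr_ge0 //; lra.
  (* The tight case is [#|F| = 2], where the bound on [u] is about 0.826. *)
  have u5 : u <= 5 / 6.
    apply: (@le_trans _ _ (v * (1 + (#|F|%:R - 1) * (1 / 8)))).
      by rewrite ler_wpM2l // lerD2l ler_wpM2l //; lra.
    have -> : v * (1 + (#|F|%:R - 1) * (1 / 8)) =
        13 / 10 * (1 + 13 / 100 * (#|F|%:R - 1)) * (1 + (#|F|%:R - 1) * (1 / 8)) / #|F|%:R.
      by rewrite /v; field.
    rewrite ler_pdivrMr; last lra.
    by nra.
  apply: (@le_trans _ _ ((5 / 6) ^+ k)); first by rewrite lerXn2r ?nnegrE //; lra.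
  apply: (@le_trans _ _ ((5 / 6) ^+ 40)); first by rewrite ler_wiXn2l ?(ltnW k41) //; lra.
  have -> : 1 / 1024 = (1 / 2) ^+ 10 :> R by field.
  rewrite (exprM _ 4 10) lerXn2r ?nnegrE ?exprn_ge0 //; lra.
have E3 : 2 * #|F|%:R^-1 ^+ (k + e) * #|F|%:R ^+ k <= 2 / 243 :> R.
  rewrite exprD mulrA mulrAC -(mulrA 2) -exprMn mulVf // expr1n mulr1.
  rewrite ler_wpM2l // exprVn lef_pV2 ?posrE ?exprn_gt0 //; last lra.
  by rewrite -natrX ler_nat.
by move: E1 E2 E3; lra.
Qed.

(** For uniform entries each nonzero vector is annihilated with probability [#|F| ^ -(k + e)], so
    fewer than [#|F| ^ k] vectors cost at most 1/36. *)
Lemma sum_zero_prob_dense (R : realFieldType) (F : finFieldType) (k e : nat) :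
    (36 <= #|F| ^ e)%N ->
  \sum_(y : 'cV[F]_k | y != 0)
    ((1 + (#|F|%:R - 1) * 0 ^+ weight y) / #|F|%:R) ^+ (k + e) <= 1 / 20 :> R.
Proof.
move=> qe; have q1 := card_field_gt1 R F.
have q0 : #|F|%:R != 0 :> R by rewrite gt_eqF //; lra.
rewrite (eq_bigr (fun=> #|F|%:R^-1 ^+ (k + e))); last first.
  by move=> y y0; rewrite expr0n gtn_eqF ?weight_gt0 // mulr0n mulr0 addr0 mul1r.
have iq0 : 0 <= #|F|%:R^-1 ^+ (k + e) :> R by rewrite exprn_ge0 // invr_ge0; lra.
apply: (@le_trans _ _ (\sum_(y : 'cV[F]_k) #|F|%:R^-1 ^+ (k + e))).
  by rewrite [leRHS](bigD1 0) //= lerDr.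
rewrite sumr_const card_mx muln1 -[leLHS]mulr_natr natrX exprD mulrAC -exprMn.
rewrite mulVf // expr1n mul1r exprVn.
have : 36 <= #|F|%:R ^+ e :> R by rewrite -natrX ler_nat.
by move=> h; rewrite -[leRHS]invrK lef_pV2 ?posrE; lra.
Qed.

(** * The random rows *)

Section RowDistribution.
Variables (R : realType) (F : finFieldType) (p : R) (l n : nat).
Hypothesis p01 : 0 <= p <= 1.

Lemma rows_mx_bij : bijective (@rows_mx F l n).
Proof.
exists (fun M => [tuple row i M | i < l]) => [v|M].
  by apply: eq_from_tnth => i; rewrite tnth_mktuple rowK.
by apply/row_matrixP => i; rewrite rowK tnth_mktuple.
Qed.

Fact row_dist_ge0 (v : l.-tuple 'rV[F]_n) :
  0 <= [ffun v : l.-tuple 'rV[F]_n => mx_dist p (rows_mx v)] v.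
Proof. by rewrite ffunE mx_dist_ge0. Qed.

Fact row_dist_sum1 :
  \sum_v [ffun v : l.-tuple 'rV[F]_n => mx_dist p (rows_mx v)] v = 1.
Proof.
rewrite -(sum_mx_dist F p l n) [RHS](reindex (@rows_mx F l n)); last first.
  exact: onW_bij rows_mx_bij.
by apply: eq_bigr => v _; rewrite ffunE.
Qed.

Definition row_dist : fdist R (l.-tuple 'rV[F]_n) := FDist row_dist_ge0 row_dist_sum1.

Lemma Pr_row_dist (P : pred 'M[F]_(l, n)) :
  Pr row_dist (fun v => P (rows_mx v)) = \sum_(M | P M) mx_dist p M.
Proof.
rewrite [RHS](reindex (@rows_mx F l n)); last exact: onW_bij rows_mx_bij.
by apply: eq_bigr => v _; rewrite /= ffunE.
Qed.

Lemma Ex_row_dist_nonzero_entries :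
  Ex row_dist (fun v => (nonzero_entries v)%:R) = p * l%:R * n%:R.
Proof.
transitivity (\sum_(M : 'M[F]_(l, n)) mx_dist p M * \sum_i \sum_j (M i j != 0)%:R).
  rewrite [RHS](reindex (@rows_mx F l n)) /=; last exact: onW_bij rows_mx_bij.
  apply: eq_bigr => v _; rewrite ffunE; congr (_ * _).
  rewrite natr_sum; apply: eq_bigr => i _.
  rewrite -sum1_card big_mkcond natr_sum; apply: eq_bigr => j _.
  by rewrite !mxE inE; case: eqP.
under eq_bigr do rewrite mulr_sumr.
rewrite exchange_big /=.
transitivity (\sum_(i < l) \sum_(j < n) p).
  apply: eq_bigr => i _; under eq_bigr do rewrite mulr_sumr.
  rewrite exchange_big /=; apply: eq_bigr => j _.
  rewrite -[RHS](sum_mx_dist_nz F p i j) [RHS]big_mkcond; apply: eq_bigr => M _.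
  by case: eqP; rewrite ?mulr0 ?mulr1.
by rewrite !sumr_const !card_ord -mulrnA -[LHS]mulr_natr natrM mulrA mulrAC.
Qed.

(** The failure bound is required for all normalized [Z], so one distribution serves every [A]. *)
Lemma Pr_row_dist_ge (m k : nat) (A : 'M[F]_(m, n)) (c : R) :
    (m <= n)%N -> (n - m)%N = k -> \rank A = m ->
    (forall (Z : 'M[F]_(n, k)) (f : 'I_k -> 'I_n), injective f -> rowsub f Z = 1%:M ->
      \sum_(M : 'M_(l, n) | ~~ col_injective (M *m Z)) mx_dist p M <= c) ->
  1 - c <= Pr row_dist (fun v => \rank (col_mx A (rows_mx v)) == n).
Proof.
move=> hmn hk rA bad; have [Z [f [finj fZ ZA]]] := kernel_parametrization hmn hk rA.
rewrite (Pr_row_dist (fun M => \rank (col_mx A M) == n)) lerBlDr.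
rewrite -(sum_mx_dist F p l n) (bigID (fun M => \rank (col_mx A M) == n)) /=.
rewrite lerD2l; apply: le_trans (bad Z f finj fZ).
rewrite big_mkcond [leRHS]big_mkcond; apply: ler_sum => M _.
case: (boolP (col_injective _)) => /= [/ZA ->|_]; first by rewrite eqxx.
by case: ifP => // _; apply: mx_dist_ge0.
Qed.

End RowDistribution.

(* The zero patterns of the random matrices over [F] and over [F'] have the same law.
   Over [F'] the rank is almost always full, which forces a matching in the support;
   given a matching in the support, a random rescaling of the matched entries by
   units of [F] makes the matrix singular only with probability [k / (#|F| - 1)]. *)
Lemma sum_not_col_injective_transfer (R : realFieldType) (F F' : finFieldType)
    (p rho : R) (l n k : nat) (Z : 'M[F]_(n, k)) (f : 'I_k -> 'I_n) :
    0 <= rho <= 1 -> p = (1 - #|F'|%:R^-1) * (1 - rho) ->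
    injective f -> rowsub f Z = 1%:M ->
  \sum_(M : 'M_(l, n) | ~~ col_injective (M *m Z)) mx_dist p M
  <= \sum_(y : 'cV[F']_k | y != 0)
        ((1 + (#|F'|%:R - 1) * rho ^+ weight y) / #|F'|%:R) ^+ l
     + k%:R / (#|F|%:R - 1).
Proof.
move=> hrho hp finj fZ; have /andP[r0 r1] := hrho.
have q1 := card_field_gt1 R F'.
have iq1 : #|F'|%:R^-1 <= 1 :> R by rewrite invf_le1 //; lra.
have iq0 : 0 <= #|F'|%:R^-1 :> R by rewrite invr_ge0; lra.
have p01 : 0 <= p <= 1 by rewrite hp mulr_ge0 ?mulr_ile1 //; lra.
rewrite (bigID (fun M => has_matching f (support_mx M))) /= addrC lerD //; last first.
  rewrite (eq_bigl _ _ (fun M => andbC _ _)); exact: sum_matching_singular_le.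
(* Multiplication by [Z'] extracts the columns [f], so injectivity over [F'] forces a matching in
   them. *)
pose Z' : 'M[F']_(n, k) := \matrix_(c, t) (c == f t)%:R.
have fZ' : rowsub f Z' = 1%:M.
  by apply/matrixP => i j; rewrite !mxE (inj_eq finj).
apply: le_trans (sum_not_col_injective_le l hrho hp finj fZ').
apply: (@le_trans _ _ (\sum_(M : 'M[F]_(l, n) | ~~ has_matching f (support_mx M))
    mx_dist p M)).
  rewrite big_mkcond [leRHS]big_mkcond; apply: ler_sum => M _.
  by case: (has_matching _ _); case: (col_injective _); rewrite //= mx_dist_ge0.
rewrite (sum_mx_dist_support F p (fun B => ~~ has_matching f B)).
rewrite -(sum_mx_dist_support F' p (fun B => ~~ has_matching f B)).
rewrite big_mkcond [leRHS]big_mkcond; apply: ler_sum => M _.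
case: (boolP (col_injective _)) => [/has_matching_support ->|_] //=.
by case: ifP => // _; apply: mx_dist_ge0.
Qed.

(** * The density, the table of constants and the final assembly *)

Section Density.
Variables (R : realType) (s k : nat).
Hypothesis k0 : (0 < k)%N.

(** The maximum keeps this a probability: for [s = 16] and [k = 41] the second argument is
    negative. *)
Definition zero_bias : R := Num.max 0 (1 - s%:R * ln k%:R / k%:R).

Let kR : 1 <= k%:R :> R. Proof. by rewrite ler1n. Qed.

Lemma zero_bias_itv : 0 <= zero_bias <= 1.
Proof.
rewrite /zero_bias le_max lexx /= ge_max ler01 /= gerBl.
by rewrite divr_ge0 // mulr_ge0 // ln_ge0.
Qed.

Lemma zero_bias_density : k%:R * (1 - zero_bias) <= s%:R * ln k%:R.
Proof.
have kp : 0 < k%:R :> R by rewrite ltr0n.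
rewrite mulrC -ler_pdivlMr // lerBlDr addrC -lerBlDr.
by rewrite /zero_bias le_max lexx orbT.
Qed.

(** From [1 - x <= exp (- x)] with [x = s ln k / k]; in the truncated case the left side is 0. *)
Lemma zero_bias_expr : zero_bias ^+ k <= k%:R ^- s.
Proof.
have kp : 0 < k%:R :> R by rewrite ltr0n.
rewrite /zero_bias; set x := s%:R * ln k%:R / k%:R.
have [h|h] := leP 0 (1 - x); last by rewrite expr0n gtn_eqF // invr_ge0 exprn_ge0.
have xe : 1 - x <= expR (- x) by have := expR_ge1Dx (- x).
apply: (@le_trans _ _ (expR (- x) ^+ k)); first by rewrite lerXn2r ?nnegrE ?expR_ge0.
rewrite -expRM_natr mulNr divfK ?gt_eqF // expRN expRM_natl lnK //.
Qed.

End Density.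

(** The fourth root of [k^-16] and the square root of [k^-6] leave the [k^-4] and [k^-3] of the two
    estimates. *)
Definition log_factor (q : nat) : nat := if (q <= 5)%N then 16 else 6.

(** Beyond [q = 7] every table entry is a number at least 6, or such a number times
    [(q - 1) / q]. *)
Lemma log_factor_sigma (R : realType) (q : nat) :
  (2 <= q)%N -> (1 - q%:R^-1) * (log_factor q)%:R <= sigma R q.
Proof.
move=> q2.
have [q7|q7] := leqP q 7.
  by do 8?[case: q q2 q7 => [|q] q2 q7 //]; rewrite /sigma /log_factor /=; lra.
have qR : 8 <= q%:R :> R by rewrite ler_nat.
have q0 : 0 < q%:R :> R by lra.
have key (c d : R) : 0 < d -> 6 * d <= c -> (1 - q%:R^-1) * 6 <= c * (q%:R - 1) / (d * q%:R).
  move=> d0 dc; have -> : 1 - q%:R^-1 = (q%:R - 1) / q%:R :> R by field; rewrite gt_eqF.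
  rewrite ler_pdivlMr ?mulr_gt0 //.
  have -> : (q%:R - 1) / q%:R * 6 * (d * q%:R) = (6 * d) * (q%:R - 1) by field; rewrite gt_eqF.
  by rewrite ler_wpM2r //; lra.
have iq0 : 0 < q%:R^-1 :> R by rewrite invr_gt0.
have key1 (c : R) : 6 <= c -> (1 - q%:R^-1) * 6 <= c * (q%:R - 1) / q%:R.
  by move=> c6; have := key c 1; rewrite mul1r; apply; lra.
rewrite /log_factor leqNgt (ltn_trans _ q7) //= /sigma.
by do 16?[case: ifP => _]; first [lra | apply: key; lra | apply: key1; lra].
Qed.

Lemma ell_le_tau (q : nat) : (ell q <= tau q)%N.
Proof. by rewrite /ell /tau; repeat case: ifP => //; lia. Qed.

Lemma expn_ell_small (q : nat) : (2 <= q <= 5)%N -> (243 <= q ^ ell q)%N.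
Proof. by case/andP; do 6?[case: q => [|q] //]. Qed.

Lemma expn_ell (q : nat) : (2 <= q)%N -> (36 <= q ^ ell q)%N.
Proof.
move=> q2; have [q5|q5] := leqP q 5.
  by rewrite (leq_trans _ (expn_ell_small _)) // q2.
have ell2 : (2 <= ell q)%N by rewrite /ell; repeat case: ifP.
by apply: (@leq_trans (q ^ 2)); [rewrite (@leq_trans (6 ^ 2)) // leq_exp2r | rewrite leq_exp2l].
Qed.

Lemma upsilon_ge41 (q : nat) : (41 <= upsilon q)%N.
Proof. by rewrite /upsilon; repeat case: ifP. Qed.

Lemma leq_false (q c i : nat) : (c < q)%N -> (i <= c)%N -> (q <= i)%N = false.
Proof. by lia. Qed.

Lemma upsilon_ge96 (q : nat) : (5 < q)%N -> (96 <= upsilon q)%N.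
Proof. by move=> q5; rewrite /upsilon; do 4!rewrite (leq_false q5) //; repeat case: ifP. Qed.

Lemma upsilon_ge1213 (q : nat) : (83 < q)%N -> upsilon q = 1213.
Proof. by move=> q83; rewrite /upsilon !(leq_false q83) //. Qed.

Lemma ell_bounds (q : nat) : (5 < q)%N -> (2 <= ell q <= 3)%N.
Proof. by move=> q5; rewrite /ell; do 3!rewrite (leq_false q5) //; case: ifP. Qed.

(** The density is only bounded above, since a very large field uses the smaller density made for 11
    elements. *)
Lemma sparse_density (R : realType) (F : finFieldType) (n k : nat) :
    (upsilon #|F| <= k)%N ->
  exists p : R, [/\ 0 <= p <= 1,
      p <= (1 - #|F|%:R^-1) * (1 - zero_bias R (log_factor #|F|) k)
    & forall (Z : 'M[F]_(n, k)) (f : 'I_k -> 'I_n), injective f -> rowsub f Z = 1%:M ->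
        \sum_(M : 'M_(k + ell #|F|, n) | ~~ col_injective (M *m Z)) mx_dist p M
        <= 1 / 10].
Proof.
set q := #|F| => kU; have q2 : (2 <= q)%N by exact: card_finNzRing_gt1.
have k41 : (41 <= k)%N by rewrite (leq_trans (upsilon_ge41 q)).
have k0 : (0 < k)%N by rewrite (leq_trans _ k41).
set rho := zero_bias R _ k.
have hrho : 0 <= rho <= 1 by exact: zero_bias_itv.
have hrk : rho ^+ k <= k%:R ^- log_factor q by exact: zero_bias_expr.
have /andP[r0 r1] := hrho.
have beta01 (N : nat) : (2 <= N)%N -> 0 <= (1 - N%:R^-1 : R) <= 1.
  move=> N2; have N2R : 2 <= N%:R :> R by rewrite ler_nat.
  have i0 : 0 <= N%:R^-1 :> R by rewrite invr_ge0; lra.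
  have i1 : N%:R^-1 <= 1 :> R by rewrite invf_le1; lra.
  lra.
have p01 N : (2 <= N)%N -> 0 <= (1 - N%:R^-1) * (1 - rho) <= 1.
  by move=> /beta01/andP[b0 b1]; rewrite mulr_ge0 ?mulr_ile1 //; lra.
have large (K : finFieldType) : (5 < q)%N -> (5 < #|K|)%N ->
    (60 * (#|K| - 1) <= k ^ 2)%N ->
    \sum_(y : 'cV[K]_k | y != 0)
      ((1 + (#|K|%:R - 1) * rho ^+ weight y) / #|K|%:R) ^+ (k + ell q) <= 1 / 20.
  move=> q5 K5 Kk; apply: sum_zero_prob_large_field => //.
  - by rewrite (leq_trans (upsilon_ge96 q5)).
  - exact: ell_bounds.
  - by move: hrk; rewrite /log_factor leqNgt q5.
have [qk|qk] := ltnP (q - 1) (20 * k).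
  exists ((1 - q%:R^-1) * (1 - rho)); split => //; first exact: p01.
  move=> Z f finj fZ; apply: le_trans (sum_not_col_injective_le _ hrho erefl finj fZ) _.
  apply: (@le_trans _ _ (1 / 20)); last lra.
  have [q5|q5] := leqP q 5.
    apply: sum_zero_prob_small_field => //.
    - by rewrite /ell; repeat case: ifP.
    - by rewrite expn_ell_small // q2.
    - by move: hrk; rewrite /log_factor q5.
  (* For [q <= 83], [60 * 82 <= 96 ^ 2] suffices; beyond, [60 (q - 1) < 1200 k <= k ^ 2] because
     [k >= 1213]. *)
  apply: large => //; have [q83|q83] := leqP q 83.
    have := leq_trans (upsilon_ge96 q5) kU; move: q83 {hrk qk kU}; rewrite -/q.
    nia.
  have : (1213 <= k)%N by apply: leq_trans kU; rewrite upsilon_ge1213.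
  by move: qk {hrk kU}; rewrite -/q; nia.
have q83 : (83 < q)%N by move: qk k41 {large hrk kU}; lia.
have k1213 : (1213 <= k)%N by apply: leq_trans kU; rewrite upsilon_ge1213.
have c11 : #|'F_11| = 11%N by exact: card_Fp.
exists ((1 - 11%:R^-1) * (1 - rho)); split; first exact: p01.
  rewrite ler_wpM2r //; first lra.
  rewrite lerD2l lerN2 lef_pV2 ?posrE ?ltr0n ?ler_nat //.
    exact: ltnW (leq_trans _ q83).
  exact: ltnW.
move=> Z f finj fZ.
apply: le_trans (sum_not_col_injective_transfer (F' := 'F_11) _ hrho _ finj fZ) _.
  by rewrite c11.
have -> : 1 / 10 = 1 / 20 + 1 / 20 :> R by lra.
rewrite lerD //.
  apply: large; rewrite ?c11 //; first exact: leq_trans _ q83.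
  by move: k1213 {hrk kU qk}; nia.
(* The threshold [20 k] is chosen to make [k / (#|F| - 1)] at most 1/20. *)
have qR : 20 * k%:R <= #|F|%:R - 1 :> R.
  by rewrite -(natrB _ (ltnW q2)) -natrM ler_nat.
have kR : 41 <= k%:R :> R by rewrite ler_nat.
rewrite ler_pdivrMr; lra.
Qed.

Theorem theorem1p1 (R : realType) (q : nat) (F : finFieldType) (hq : #|F| = q)
    (m n : nat) (hmn : (m <= n)%N) (hn : (1 <= n)%N) :
  exists P : fdist R ((n - m + ell q)%N.-tuple 'rV[F]_n),
    [/\ (upsilon q <= n - m)%N ->
          Ex P (fun v => (nonzero_entries v)%:R)
            <= sigma R q * n%:R * ln n%:R + (tau q)%:R * n%:R,
        ~~ (upsilon q <= n - m)%N ->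
          Ex P (fun v => (nonzero_entries v)%:R)
            <= (q%:R - 1) / q%:R * (n - m + ell q)%:R * n%:R
          /\ (q%:R - 1) / q%:R * (n - m + ell q)%:R * n%:R
            <= (q%:R - 1) / q%:R * (upsilon q + ell q)%:R * n%:R :> R
      & forall A : 'M[F]_(m, n), \rank A = m ->
          ((q <= n ^ 2)%N ->
             9 / 10 <= Pr P (fun v => \rank (col_mx A (rows_mx v)) == n))
          /\ ((n ^ 2 < q)%N ->
             9 / 10 - 9 / (10 * n%:R)
               <= Pr P (fun v => \rank (col_mx A (rows_mx v)) == n))].
Proof.
have q2 : (2 <= q)%N by rewrite -hq card_finNzRing_gt1.
have q2R : 2 <= q%:R :> R by rewrite ler_nat.
have nR : 1 <= n%:R :> R by rewrite ler1n.
have bE : (q%:R - 1) / q%:R = 1 - q%:R^-1 :> R by field; rewrite gt_eqF //; lra.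
have iq0 : 0 <= q%:R^-1 :> R by rewrite invr_ge0; lra.
have iq1 : q%:R^-1 <= 1 :> R by rewrite invf_le1; lra.
have weaken (P : fdist R ((n - m + ell q)%N.-tuple 'rV[F]_n)) (A : 'M[F]_(m, n)) :
    1 - 1 / 10 <= Pr P (fun v => \rank (col_mx A (rows_mx v)) == n) ->
    ((q <= n ^ 2)%N -> 9 / 10 <= Pr P (fun v => \rank (col_mx A (rows_mx v)) == n))
    /\ ((n ^ 2 < q)%N -> 9 / 10 - 9 / (10 * n%:R)
         <= Pr P (fun v => \rank (col_mx A (rows_mx v)) == n)).
  have pos : 0 <= 9 / (10 * n%:R) :> R by rewrite divr_ge0 ?mulr_ge0.
  by move=> h; split => _; lra.
have [kU|kU] := leqP (upsilon q) (n - m).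
  have k0 : (0 < n - m)%N by rewrite (leq_trans _ kU) // (leq_trans _ (upsilon_ge41 q)).
  have kU' : (upsilon #|F| <= n - m)%N by rewrite hq.
  have [p [p01 p_le bad]] := sparse_density R n kU'; rewrite hq in p_le bad.
  exists (row_dist F (n - m + ell q) n p01); split => // [_|A rA]; last first.
    by apply: weaken; apply: (Pr_row_dist_ge p01 hmn erefl rA).
  rewrite Ex_row_dist_nonzero_entries.
  set k := (n - m)%N in k0 p_le *; set s := log_factor q in p_le *.
  set rho := zero_bias R s k in p_le *.
  have /andP[r0 r1] := zero_bias_itv R s k0; rewrite -/rho in r0 r1.
  have kn : ln k%:R <= ln n%:R :> R.
    by rewrite ler_ln ?posrE ?ltr0n // ler_nat leq_subr.
  have dens : k%:R * (1 - rho) <= s%:R * ln n%:R.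
    by apply: le_trans (zero_bias_density R s k0) _; rewrite ler_wpM2l.
  have lnn : 0 <= ln n%:R :> R by rewrite ln_ge0.
  have st : (1 - q%:R^-1) * s%:R <= sigma R q by exact: log_factor_sigma.
  have lt : (ell q)%:R <= (tau q)%:R :> R by rewrite ler_nat ell_le_tau.
  (* The first [k] rows are paid by [sigma], and the [ell q] extra rows by [tau], as [p <= 1] and
     [ell q <= tau q]. *)
  have rows_le : p * (k%:R + (ell q)%:R) <= sigma R q * ln n%:R + (tau q)%:R.
    have b0 : 0 <= 1 - q%:R^-1 :> R by lra.
    have h1 : p * k%:R <= sigma R q * ln n%:R.
      apply: (@le_trans _ _ ((1 - q%:R^-1) * (k%:R * (1 - rho)))).
        by rewrite mulrCA mulrC ler_wpM2l.
      apply: (@le_trans _ _ ((1 - q%:R^-1) * (s%:R * ln n%:R))).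
        by rewrite ler_wpM2l.
      by rewrite mulrA ler_wpM2r.
    have h2 : p * (ell q)%:R <= (tau q)%:R.
      have /andP[p0 p1] := p01.
      by apply: le_trans lt; rewrite ler_piMl.
    lra.
  have -> : sigma R q * n%:R * ln n%:R + (tau q)%:R * n%:R
      = (sigma R q * ln n%:R + (tau q)%:R) * n%:R by ring.
  by rewrite natrD ler_wpM2r.
(* For few rows the entries are uniform on [F], which is the case [rho = 0]. *)
have p01 : 0 <= ((q%:R - 1) / q%:R : R) <= 1 by rewrite bE; lra.
exists (row_dist F (n - m + ell q) n p01); split => // [_|A rA].
  rewrite Ex_row_dist_nonzero_entries; split => //.
  have /andP[b0 _] := p01.
  by rewrite ler_wpM2r // ler_wpM2l // ler_nat leq_add2r ltnW.
apply: weaken; apply: (Pr_row_dist_ge p01 hmn erefl rA) => Z f finj fZ.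
have h0 : 0 <= (0 : R) <= 1 by rewrite lexx ler01.
have pE : (q%:R - 1) / q%:R = (1 - #|F|%:R^-1) * (1 - 0) :> R.
  by rewrite hq subr0 mulr1.
apply: le_trans (sum_not_col_injective_le _ h0 pE finj fZ) _.
apply: (@le_trans _ _ (1 / 20)); last lra.
by apply: sum_zero_prob_dense; rewrite hq expn_ell.
Qed.
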